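(* Let $\mathfrak{g}=\mathfrak{sl}(2,\mathbb{C})\oplus\mathfrak{n}_3$ be the six-dimensional complex Lie algebra, semidirect product of $\mathfrak{sl}(2,\mathbb{C})$ (basis $h,e,f$) by the Heisenberg algebra $\mathfrak{n}_3$ (basis $p,q,z$), with brackets $$[h,e]=2e,\ [h,f]=-2f,\ [e,f]=h,\ [q,p]=z,\ [h,q]=q,\ [h,p]=-p,\ [e,p]=q,\ [f,q]=p,$$ all other brackets of basis elements being zero or deduced by antisymmetry. Let $P\in\mathcal{S}\mathfrak{g}\otimes\Lambda^2\mathfrak{n}_3^*$ be defined by $P:=C\,q^*\wedge p^*$ with $C:=h^2+4ef$ (the quadratic Casimir element of $\mathcal{S}\mathfrak{sl}(2,\mathbb{C})$), where $p^*,q^*,z^*$ is the basis of $\mathfrak{n}_3^*$ dual to $p,q,z$. Then $P$ is $\mathfrak{sl}(2,\mathbb{C})$-invariant, $[P,P]_s=0=[P_0,P]_s$, and $P$ is not cohomologous to $0$ in $\mathbf{H}^2_{CE}(\mathfrak{n}_3,\mathcal{S}\mathfrak{g})^{\mathfrak{sl}(2,\mathbb{C})}$. In particular, $\mathfrak{g}$ is not strongly rigid.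
   Context: $\mathcal{S}\mathfrak{g}$ is the symmetric algebra, identified with the polynomial functions on $\mathfrak{g}^*$, with $\mathfrak{g}$ acting by the extension of the adjoint action by derivations. Elements of $\mathcal{S}\mathfrak{g}\otimes\Lambda^k\mathfrak{g}^*$ are identified with polynomial $k$-vector fields on $\mathfrak{g}^*$; here $\mathfrak{n}_3^*\subset\mathfrak{g}^*$ via the dual basis of $(h,e,f,p,q,z)$, so that $q^*\wedge p^*$ is the constant bivector field $\partial_q\wedge\partial_p$ and $P$ is a bivector field. $[\cdot,\cdot]_s$ is the Schouten bracket, and $P_0$ is the linear Poisson structure on $\mathfrak{g}^*$: $\{x,y\}=[x,y]$ for $x,y\in\mathfrak{g}$. $\mathbf{H}_{CE}$ denotes Chevalley–Eilenberg cohomology, and the superscript denotes $\mathfrak{sl}(2,\mathbb{C})$-invariants. A formal associative deformation of an associative $\mathbb{C}$-algebra $(\mathcal{A},\mu_0)$ is an associative $\mathbb{C}[[t]]$-bilinear product $\mu_t=\mu_0+t\mu_1+t^2\mu_2+\cdots$ on $\mathcal{A}[[t]]$; it is trivial if there is $\varphi_t=\mathrm{Id}+t\varphi_1+\cdots$ with $\varphi_r\in\mathrm{Hom}(\mathcal{A},\mathcal{A})$ and $\varphi_t(\mu_t(a,b))=\mu_0(\varphi_t(a),\varphi_t(b))$. The algebra $\mathcal{A}$ is rigid if every formal associative deformation is trivial. A Lie algebra $\mathfrak{g}$ is strongly rigid if its universal enveloping algebra $\mathcal{U}\mathfrak{g}$ is rigid as an associative algebra. *)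

(* Defs.v *)
From HB Require Import structures.
From mathcomp Require Import all_boot all_order all_algebra.
From mathcomp Require Import reals complex.
From mathcomp Require Import mpoly.
From mathcomp Require Import ring.

Set Implicit Arguments.
Unset Strict Implicit.
Unset Printing Implicit Defensive.
Import GRing.Theory.
Local Open Scope ring_scope.

HB.mixin Record Lmodule_isLieAlgebra (K : fieldType) L
    & GRing.Lmodule K L := {
  lie : L -> L -> L;
  lie_linearl : forall a x y w, lie (a *: x + y) w = a *: lie x w + lie y w;
  lie_linearr : forall a w x y, lie w (a *: x + y) = a *: lie w x + lie w y;
  liexx : forall x, lie x x = 0;
  lie_jacobi : forall x y w,
    lie x (lie y w) + lie y (lie w x) + lie w (lie x y) = 0
}.

#[short(type="lieAlgType")]
HB.structure Definition LieAlgebra (K : fieldType) :=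
  {L of Lmodule_isLieAlgebra K L & GRing.Lmodule K L}.

Lemma lie0r (K : fieldType) (L : lieAlgType K) (x : L) : lie x 0 = 0.
Proof.
by have := lie_linearr (-1) x 0 0; rewrite scaler0 addr0 scaleN1r addNr.
Qed.

Lemma lieN (K : fieldType) (L : lieAlgType K) (x y : L) : lie y x = - lie x y.
Proof.
apply/eqP; rewrite -addr_eq0.
have lieDl (u v w : L) : lie (u + v) w = lie u w + lie v w.
  by have := lie_linearl 1 u v w; rewrite !scale1r.
have lieDr (u v w : L) : lie w (u + v) = lie w u + lie w v.
  by have := lie_linearr 1 w u v; rewrite !scale1r.
have := liexx (x + y).
by rewrite lieDl !lieDr !liexx add0r addr0 addrC => ->.
Qed.

Lemma lieNr (K : fieldType) (L : lieAlgType K) (x y : L) :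
  lie x (- y) = - lie x y.
Proof.
by have := lie_linearr (-1) x y 0; rewrite !scaleN1r lie0r !addr0.
Qed.

Definition lie_action (K : fieldType) (L : lieAlgType K) (M : lmodType K)
    (act : L -> M -> M) : Prop :=
  [/\ forall m, linear (act^~ m),
      forall x, linear (act x)
    & forall x y m, act (lie x y) m = act x (act y m) - act y (act x m)].

(* The Chevalley-Eilenberg complex C^1(L, M) -> C^2(L, M) -> C^3(L, M), where
   k-cochains are the alternating k-linear maps and L acts on M through act. *)
Section ChevalleyEilenberg.
Variables (K : fieldType) (L : lieAlgType K) (M : lmodType K).
Variable act : L -> M -> M.

Definition ce_cochain2 (c : L -> L -> M) : Prop :=
  [/\ forall y, linear (c^~ y), forall x, linear (c x) & forall x, c x x = 0].

Definition ce_d1 (phi : L -> M) (x y : L) : M :=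
  act x (phi y) - act y (phi x) - phi (lie x y).

Definition ce_d2 (c : L -> L -> M) (x y w : L) : M :=
  act x (c y w) - act y (c x w) + act w (c x y)
  - c (lie x y) w + c (lie x w) y - c (lie y w) x.

Definition ce_cocycle2 (c : L -> L -> M) : Prop :=
  ce_cochain2 c /\ forall x y w, ce_d2 c x y w = 0.

Definition ce_coboundary2 (c : L -> L -> M) : Prop :=
  exists phi : {linear L -> M}, forall x y, c x y = ce_d1 phi x y.

Definition ce_cohomologous2 (c c' : L -> L -> M) : Prop :=
  ce_coboundary2 (fun x y => c x y - c' x y).

End ChevalleyEilenberg.

(* A[[t]] is represented by the sequences of coefficients nat -> A. *)
Section FormalDeformations.
Variables (K : fieldType) (A : algType K).

Definition fps_bilin (mu : nat -> A -> A -> A) (a b : nat -> A) : nat -> A :=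
  fun n => \sum_(i < n.+1) \sum_(j < (n - i).+1) mu (n - i - j)%N (a i) (b j).

Definition fps_lin (phi : nat -> A -> A) (a : nat -> A) : nat -> A :=
  fun n => \sum_(i < n.+1) phi (n - i)%N (a i).

Definition fps_mul (a b : nat -> A) : nat -> A :=
  fun n => \sum_(i < n.+1) a i * b (n - i)%N.

(* The C[[t]]-bilinear products on A[[t]] are the fps_bilin mu with every mu r
   bilinear over K. *)
Definition formal_deformation (mu : nat -> A -> A -> A) : Prop :=
  [/\ forall r b, linear ((mu r)^~ b),
      forall r a, linear (mu r a),
      forall a b, mu 0%N a b = a * b
    & forall a b c, fps_bilin mu (fps_bilin mu a b) c
                    =1 fps_bilin mu a (fps_bilin mu b c)].

Definition trivial_deformation (mu : nat -> A -> A -> A) : Prop :=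
  exists phi : nat -> {linear A -> A},
    (forall a, phi 0%N a = a) /\
    forall a b, fps_lin phi (fps_bilin mu a b)
                =1 fps_mul (fps_lin phi a) (fps_lin phi b).

Definition rigid : Prop :=
  forall mu, formal_deformation mu -> trivial_deformation mu.

End FormalDeformations.

Definition lie_to_assoc (K : fieldType) (L : lieAlgType K) (A : algType K)
    (f : L -> A) : Prop :=
  forall x y, f (lie x y) = f x * f y - f y * f x.

Definition universal_enveloping (K : fieldType) (L : lieAlgType K)
    (U : algType K) (iota : {linear L -> U}) : Prop :=
  lie_to_assoc iota /\
  forall (A : algType K) (f : {linear L -> A}), lie_to_assoc f ->
    exists F : {lrmorphism U -> A},
      (forall x, F (iota x) = f x) /\
      forall G : {lrmorphism U -> A}, (forall x, G (iota x) = f x) -> G =1 F.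

(* Enveloping algebras are unique up to isomorphism, and the negation of this
   statement entails that one exists. *)
Definition strongly_rigid (K : fieldType) (L : lieAlgType K) : Prop :=
  forall (U : algType K) (iota : {linear L -> U}),
    universal_enveloping iota -> rigid U.

Definition ih : 'I_6 := @Ordinal 6 0 isT.
Definition ie : 'I_6 := @Ordinal 6 1 isT.
Definition if_ : 'I_6 := @Ordinal 6 2 isT.
Definition ip : 'I_6 := @Ordinal 6 3 isT.
Definition iq : 'I_6 := @Ordinal 6 4 isT.
Definition iz : 'I_6 := @Ordinal 6 5 isT.

Definition sl2n3 (K : fieldType) : Type := 'rV[K]_6.
HB.instance Definition _ (K : fieldType) := Vector.on (sl2n3 K).

Section Sl2Heisenberg.
Variable K : fieldType.
Local Notation g := (sl2n3 K).

Definition coordg (i : 'I_6) (x : g) : K := (x : 'rV[K]_6) 0 i.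
Definition basisg (i : 'I_6) : g := (delta_mx 0 i : 'rV[K]_6).

Definition bracket_table : seq ('I_6 * 'I_6 * g) :=
  [:: (ih, ie, 2%:R *: basisg ie); (ih, if_, - 2%:R *: basisg if_);
      (ie, if_, basisg ih);        (iq, ip, basisg iz);
      (ih, iq, basisg iq);         (ih, ip, - basisg ip);
      (ie, ip, basisg iq);         (if_, iq, basisg ip)].

Definition bracketg (x y : g) : g :=
  \sum_(t <- bracket_table)
    (coordg t.1.1 x * coordg t.1.2 y - coordg t.1.2 x * coordg t.1.1 y) *: t.2.

Lemma coordg_linear i : scalar (coordg i).
Proof. by move=> a x y; rewrite /coordg !mxE. Qed.

Lemma coordg_basis i j : coordg i (basisg j) = (i == j)%:R.
Proof. by rewrite /coordg /basisg mxE. Qed.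

HB.instance Definition _ i :=
  GRing.isLinear.Build K g K *%R (coordg i) (coordg_linear i).

Lemma coordgP (x y : g) : (forall i, coordg i x = coordg i y) -> x = y.
Proof. by move=> e; apply/rowP => i; exact: e. Qed.

Lemma coordgE (x y : g) :
  (coordg ih (bracketg x y)
    = coordg ie x * coordg if_ y - coordg if_ x * coordg ie y) *
  (coordg ie (bracketg x y)
    = 2%:R * (coordg ih x * coordg ie y - coordg ie x * coordg ih y)) *
  (coordg if_ (bracketg x y)
    = - 2%:R * (coordg ih x * coordg if_ y - coordg if_ x * coordg ih y)) *
  (coordg ip (bracketg x y)
    = - (coordg ih x * coordg ip y - coordg ip x * coordg ih y)
      + (coordg if_ x * coordg iq y - coordg iq x * coordg if_ y)) *
  (coordg iq (bracketg x y)
    = (coordg ih x * coordg iq y - coordg iq x * coordg ih y)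
      + (coordg ie x * coordg ip y - coordg ip x * coordg ie y)) *
  (coordg iz (bracketg x y)
    = coordg iq x * coordg ip y - coordg ip x * coordg iq y).
Proof.
rewrite /bracketg /bracket_table !big_cons big_nil /=.
do !split; rewrite !(linearD, linearZ, linearN, linear0) /= !coordg_basis /=;
  ring.
Qed.

Lemma ord6P (P : 'I_6 -> Prop) :
  P ih -> P ie -> P if_ -> P ip -> P iq -> P iz -> forall i, P i.
Proof.
move=> P0 P1 P2 P3 P4 P5; case=> [[|[|[|[|[|[|//]]]]]]] lti.
- by rewrite (_ : Ordinal lti = ih) //; exact/val_inj.
- by rewrite (_ : Ordinal lti = ie) //; exact/val_inj.
- by rewrite (_ : Ordinal lti = if_) //; exact/val_inj.
- by rewrite (_ : Ordinal lti = ip) //; exact/val_inj.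
- by rewrite (_ : Ordinal lti = iq) //; exact/val_inj.
- by rewrite (_ : Ordinal lti = iz) //; exact/val_inj.
Qed.

Fact bracketg_linearl a x y w :
  bracketg (a *: x + y) w = a *: bracketg x w + bracketg y w.
Proof.
apply: coordgP; elim/ord6P;
rewrite !(linearD, linearZ) /= !coordgE !(linearD, linearZ) /=; ring.
Qed.

Fact bracketg_linearr a w x y :
  bracketg w (a *: x + y) = a *: bracketg w x + bracketg w y.
Proof.
apply: coordgP; elim/ord6P;
rewrite !(linearD, linearZ) /= !coordgE !(linearD, linearZ) /=; ring.
Qed.

Fact bracketgxx x : bracketg x x = 0.
Proof. by apply: coordgP; elim/ord6P; rewrite !linear0 !coordgE; ring. Qed.

Fact bracketg_jacobi x y w :
  bracketg x (bracketg y w) + bracketg y (bracketg w x)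
  + bracketg w (bracketg x y) = 0.
Proof.
by apply: coordgP; elim/ord6P; rewrite !linearD linear0 /= !coordgE; ring.
Qed.

HB.instance Definition _ := Lmodule_isLieAlgebra.Build K (sl2n3 K)
  bracketg_linearl bracketg_linearr bracketgxx bracketg_jacobi.

Definition sl2 : {vspace g} := <<[:: basisg ih; basisg ie; basisg if_]>>%VS.
Definition n3_vspace : {vspace g} :=
  <<[:: basisg ip; basisg iq; basisg iz]>>%VS.

Lemma mem_n3P x : reflect
  [/\ coordg ih x = 0, coordg ie x = 0 & coordg if_ x = 0] (x \in n3_vspace).
Proof.
apply: (iffP idP) => [|[x0 x1 x2]].
  rewrite /n3_vspace !span_cons span_nil addv0.
  case/memv_addP => _ /vlineP[a ->] [_ /memv_addP[_ /vlineP[b ->]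
    [_ /vlineP[c ->] ->]] ->].
  by split; rewrite !(linearD, linearZ) /= !coordg_basis /=; ring.
have -> : x = coordg ip x *: basisg ip + coordg iq x *: basisg iq
              + coordg iz x *: basisg iz.
  apply: coordgP; elim/ord6P;
  rewrite !(linearD, linearZ) /= !coordg_basis /= ?(x0, x1, x2); ring.
by rewrite !memvD // memvZ // memv_span // !inE eqxx ?orbT.
Qed.

Lemma n3_ideal (x u : g) : u \in n3_vspace -> lie x u \in n3_vspace.
Proof.
by case/mem_n3P => u0 u1 u2; apply/mem_n3P; split;
  rewrite /lie /= !coordgE ?(u0, u1, u2); ring.
Qed.

End Sl2Heisenberg.

Definition n3 (K : fieldType) : Type := subvs_of (n3_vspace K).
HB.instance Definition _ (K : fieldType) := Vector.on (n3 K).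

Section PolyvectorFields.
Variable K : fieldType.
Local Notation g := (sl2n3 K).

Definition n3_incl (u : n3 K) : g := vsval u.

(* vsproj is used only on vectors of n3_vspace, which is an ideal of g. *)
Definition ad_n3 (x : g) (u : n3 K) : n3 K :=
  vsproj (n3_vspace K) (lie x (n3_incl u)).

Definition bracket_n3 (u v : n3 K) : n3 K := ad_n3 (n3_incl u) v.

Lemma ad_n3E x u : n3_incl (ad_n3 x u) = lie x (n3_incl u).
Proof. by rewrite /n3_incl /ad_n3 vsprojK // n3_ideal // subvsP. Qed.

Lemma bracket_n3E u v :
  n3_incl (bracket_n3 u v) = lie (n3_incl u) (n3_incl v).
Proof. exact: ad_n3E. Qed.

Fact n3_incl_linear : linear n3_incl.
Proof. exact: linearP. Qed.

HB.instance Definition _ :=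
  GRing.isLinear.Build K (n3 K) g _ n3_incl n3_incl_linear.

Lemma n3_incl_inj : injective n3_incl.
Proof. exact: subvs_inj. Qed.

Fact n3_inclD u v : n3_incl (u + v) = n3_incl u + n3_incl v.
Proof. exact: linearD. Qed.

Fact n3_incl0 : n3_incl 0 = 0.
Proof. exact: linear0. Qed.

Fact bracket_n3_linearl a (x y w : n3 K) :
  bracket_n3 (a *: x + y) w = a *: bracket_n3 x w + bracket_n3 y w.
Proof.
apply: n3_incl_inj; rewrite bracket_n3E n3_incl_linear lie_linearl.
by rewrite n3_incl_linear !bracket_n3E.
Qed.

Fact bracket_n3_linearr a (w x y : n3 K) :
  bracket_n3 w (a *: x + y) = a *: bracket_n3 w x + bracket_n3 w y.
Proof.
apply: n3_incl_inj; rewrite bracket_n3E n3_incl_linear lie_linearr.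
by rewrite n3_incl_linear !bracket_n3E.
Qed.

Fact bracket_n3xx (x : n3 K) : bracket_n3 x x = 0.
Proof. by apply: n3_incl_inj; rewrite bracket_n3E liexx n3_incl0. Qed.

Fact bracket_n3_jacobi (x y w : n3 K) :
  bracket_n3 x (bracket_n3 y w) + bracket_n3 y (bracket_n3 w x)
  + bracket_n3 w (bracket_n3 x y) = 0.
Proof.
by apply: n3_incl_inj; rewrite !n3_inclD !bracket_n3E lie_jacobi n3_incl0.
Qed.

HB.instance Definition _ := Lmodule_isLieAlgebra.Build K (n3 K)
  bracket_n3_linearl bracket_n3_linearr bracket_n3xx bracket_n3_jacobi.

(* The symmetric algebra of g, in the basis (h, e, f, p, q, z). *)
Local Notation Sg := {mpoly K[6]}.

Definition sym_incl (x : g) : Sg := \sum_i coordg i x *: 'X_i.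

(* The derivation of Sg extending ad x. *)
Definition sym_act (x : g) (F : Sg) : Sg :=
  \sum_i sym_incl (lie x (basisg K i)) * F^`M(i).

Lemma mderiv_sym_incl i x : (sym_incl x)^`M(i) = (coordg i x)%:MP.
Proof.
rewrite /sym_incl linear_sum (bigD1 i) //= linearZ /= mderivX mnmE eqxx.
rewrite big1 => [|j ne_ji]; last first.
  by rewrite linearZ /= mderivX mnmE (negPf ne_ji) scale0r scaler0.
rewrite addr0 (_ : (U_(i) - U_(i))%MM = 0%MM) ?mpolyX0 ?scale1r ?alg_mpolyC //.
by apply/mnmP => j; rewrite mnmBE mnm0E subnn.
Qed.

Lemma sym_incl_linear : linear sym_incl.
Proof.
move=> a x y; rewrite /sym_incl scaler_sumr -big_split /=.
by apply: eq_bigr => i _; rewrite linearP /= scalerDl scalerA.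
Qed.

HB.instance Definition _ :=
  GRing.isLinear.Build K g Sg _ sym_incl sym_incl_linear.

Lemma sum_coordg (x : g) : x = \sum_i coordg i x *: basisg K i.
Proof.
apply: coordgP => j; rewrite linear_sum (bigD1 j) //= linearZ /= coordg_basis.
rewrite eqxx mulr1 big1 ?addr0 // => i ne_ij.
by rewrite linearZ /= coordg_basis eq_sym (negPf ne_ij) mulr0.
Qed.

Lemma sym_act_incl x y : sym_act x (sym_incl y) = sym_incl (lie x y).
Proof.
rewrite /sym_act {2}[y]sum_coordg.
have -> : lie x (\sum_i coordg i y *: basisg K i) =
          \sum_i coordg i y *: lie x (basisg K i).
  elim/big_rec2: _ => [|i u v _ <-]; [exact: lie0r | exact: lie_linearr].
rewrite linear_sum; apply: eq_bigr => i _.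
by rewrite mderiv_sym_incl linearZ /= mulrC mul_mpolyC.
Qed.

Lemma sym_actM x F G :
  sym_act x (F * G) = sym_act x F * G + F * sym_act x G.
Proof.
rewrite /sym_act mulr_suml mulr_sumr -big_split /=; apply: eq_bigr => i _.
by rewrite mderivM; ring.
Qed.

Lemma sym_act_linear x : linear (sym_act x).
Proof.
move=> a F G; rewrite /sym_act scaler_sumr -big_split /=.
by apply: eq_bigr => i _; rewrite linearP /= mulrDr scalerAr.
Qed.

HB.instance Definition _ x :=
  GRing.isLinear.Build K Sg Sg _ (sym_act x) (sym_act_linear x).

Lemma sym_act_lie_action : lie_action sym_act.
Proof.
split; [move=> F a x y | exact: sym_act_linear | move=> x y F].
  rewrite /sym_act scaler_sumr -big_split /=; apply: eq_bigr => i _.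
  by rewrite lie_linearl linearP mulrDl scalerAl.
have act0 u : sym_act u 0 = 0 by exact: linear0.
have actD u F1 F2 : sym_act u (F1 + F2) = sym_act u F1 + sym_act u F2.
  exact: linearD.
have actZ u a F1 : sym_act u (a *: F1) = a *: sym_act u F1 by exact: linearZ.
elim/mpolyind: F => [|a m F _ _ IH]; first by rewrite !act0 subr0.
rewrite !actD !actZ IH opprD addrACA; congr (_ + _).
rewrite -scalerBr; congr (_ *: _).
have act1 u : sym_act u 1 = 0.
  by rewrite /sym_act big1 // => i _; rewrite -mpolyC1 mderivC mulr0.
rewrite mpolyXE_id; elim/big_rec: _ => [|i G _ IHG].
  by rewrite !act1 !act0 subr0.
have actX : sym_act (lie x y) 'X_i
            = sym_act x (sym_act y 'X_i) - sym_act y (sym_act x 'X_i).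
  have -> : 'X_i = sym_incl (basisg K i).
    rewrite /sym_incl (bigD1 i) //= coordg_basis eqxx scale1r big1 ?addr0 //.
    by move=> j ne_ji; rewrite coordg_basis (negPf ne_ji) scale0r.
  rewrite !sym_act_incl -linearB /=; congr sym_incl.
  have := lie_jacobi x y (basisg K i).
  rewrite [lie (basisg K i) x]lieN lieNr [lie (basisg K i) _]lieN.
  by move/eqP; rewrite subr_eq0 => /eqP.
have actXn k : sym_act (lie x y) ('X_i ^+ k)
            = sym_act x (sym_act y ('X_i ^+ k)) - sym_act y (sym_act x ('X_i ^+ k)).
  elim: k => [|k IHk]; first by rewrite expr0 !act1 !act0 subr0.
  by rewrite exprS !sym_actM !actD !sym_actM IHk actX; ring.
by rewrite !sym_actM !actD !sym_actM IHG actXn; ring.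
Qed.

Definition sym_act_n3 (u : n3 K) (F : Sg) : Sg := sym_act (n3_incl u) F.

(* A bivector field on g^*, i.e. an element of Sg (x) Lambda^2 g^*, is an
   alternating bilinear map g -> g -> Sg; biderivation B F G is its value on
   the differentials of the functions F and G. *)
Definition biderivation (B : g -> g -> Sg) (F G : Sg) : Sg :=
  \sum_i \sum_j B (basisg K i) (basisg K j) * F^`M(i) * G^`M(j).

(* The Schouten bracket of two bivector fields, as an alternating trilinear map
   on g, normalized so that schouten2 B B is twice the Jacobiator of B. *)
Definition schouten2 (B B' : g -> g -> Sg) (x y w : g) : Sg :=
  let half (B1 B2 : g -> g -> Sg) :=
    biderivation B1 (B2 x y) (sym_incl w)
    + biderivation B1 (B2 y w) (sym_incl x)
    + biderivation B1 (B2 w x) (sym_incl y) in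
  half B B' + half B' B.

Definition poisson0 (x y : g) : Sg := sym_incl (lie x y).

Definition casimir : Sg :=
  'X_ih ^+ 2 + 4%:R * 'X_ie * 'X_if_.

Definition wedge (u v : g -> K) (x y : g) : K := u x * v y - u y * v x.

(* P = C q^* /\ p^*; n3^* embeds into g^* through the dual basis, so P vanishes
   as soon as one argument lies in sl2. *)
Definition bivP (x y : g) : Sg := wedge (coordg iq) (coordg ip) x y *: casimir.

Definition restr_n3 (B : g -> g -> Sg) (u v : n3 K) : Sg :=
  B (n3_incl u) (n3_incl v).

Definition act_cochain2 (x : g) (c : n3 K -> n3 K -> Sg) (u v : n3 K) : Sg :=
  sym_act x (c u v) - c (ad_n3 x u) v - c u (ad_n3 x v).

Definition sl2_invariant (c : n3 K -> n3 K -> Sg) : Prop :=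
  forall x, x \in sl2 K -> forall u v, act_cochain2 x c u v = 0.

(* The class of c belongs to the sl2-invariants of H^2(n3, Sg). *)
Definition in_H2_invariants (c : n3 K -> n3 K -> Sg) : Prop :=
  ce_cocycle2 sym_act_n3 c /\
  forall x, x \in sl2 K ->
    ce_cohomologous2 sym_act_n3 (act_cochain2 x c) (fun _ _ => 0).

End PolyvectorFields.

Arguments bivP : clear implicits.
Arguments poisson0 : clear implicits.
Arguments sym_act_n3 : clear implicits.

(* Main.v *)
Require Import Defs.
From HB Require Import structures.
From mathcomp Require Import all_boot all_order all_algebra.
From mathcomp Require Import reals complex mpoly polyXY ring zify.
Set Implicit Arguments.
Unset Strict Implicit.
Unset Printing Implicit Defensive.
Import GRing.Theory.
Local Open Scope ring_scope.

(** [P] is quantized by the algebra [U_t] with the generators and relations of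
    [U g], except that [q p - p q = z + t C]. Its ordered monomials
    [p^i t^r f^a q^b e^c h^d z^l] form a basis: the left multiplications by the
    generators are written down on the space spanned by these monomials ([e] and
    [q] by recursion on [i]), and satisfy the relations by induction on [i].
    Hence any module over the relations is acted upon by that space, which
    yields the associative product of [U_t], the universal property of
    [U g = U_t / (t)], and the deformation [mu_t].

    If [mu_t] were trivial, the first order terms [q1, p1, z1] of the
    equivalence would satisfy [C + z1 = [q1, p] + [q, p1]] and [[z1, q] = 0] in
    [U g]. In the affine representation on [K + K^2], all elements are block
    triangular, [p] and [q] strictly so; the diagonal blocks [0] and [3] of [C]
    force those of [z1] to be [0] and [-3], and then [z1] does not commute with
    [q]. The cohomology class of [P] is nonzero for the same reason: [C + phi z]
    lies in the ideal [(p, q, z)] of [S g] while [q . phi z = 0], which makes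
    [d(phi z)/dh] vanish on [p = q = z = 0], unlike [dC/dh = 2 h]. *)

(** * Modules over the deformed algebra *)

(* [hmT] is the action of [t], and [h^2 + 2 h + 4 f e] is the ordered form of
   the symmetrization of the Casimir element [h^2 + 4 e f]. *)
Record hecke_module (K : fieldType) (M : lmodType K) := HeckeModule {
  hmP : {linear M -> M}; hmF : {linear M -> M}; hmQ : {linear M -> M};
  hmE : {linear M -> M}; hmH : {linear M -> M}; hmZ : {linear M -> M};
  hmT : {linear M -> M};
  hmZP : forall m, hmZ (hmP m) = hmP (hmZ m);
  hmZF : forall m, hmZ (hmF m) = hmF (hmZ m);
  hmZQ : forall m, hmZ (hmQ m) = hmQ (hmZ m);
  hmZE : forall m, hmZ (hmE m) = hmE (hmZ m);
  hmZH : forall m, hmZ (hmH m) = hmH (hmZ m);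
  hmTP : forall m, hmT (hmP m) = hmP (hmT m);
  hmTF : forall m, hmT (hmF m) = hmF (hmT m);
  hmTQ : forall m, hmT (hmQ m) = hmQ (hmT m);
  hmTE : forall m, hmT (hmE m) = hmE (hmT m);
  hmTH : forall m, hmT (hmH m) = hmH (hmT m);
  hmTZ : forall m, hmT (hmZ m) = hmZ (hmT m);
  hmFP : forall m, hmF (hmP m) = hmP (hmF m);
  hmHP : forall m, hmH (hmP m) = hmP (hmH m) - hmP m;
  hmHF : forall m, hmH (hmF m) = hmF (hmH m) - hmF m *+ 2;
  hmHQ : forall m, hmH (hmQ m) = hmQ (hmH m) + hmQ m;
  hmHE : forall m, hmH (hmE m) = hmE (hmH m) + hmE m *+ 2;
  hmEP : forall m, hmE (hmP m) = hmP (hmE m) + hmQ m;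
  hmEF : forall m, hmE (hmF m) = hmF (hmE m) + hmH m;
  hmEQ : forall m, hmE (hmQ m) = hmQ (hmE m);
  hmFQ : forall m, hmF (hmQ m) = hmQ (hmF m) + hmP m;
  hmQP : forall m, hmQ (hmP m) = hmP (hmQ m) + hmZ m
    + hmT (hmH (hmH m) + hmH m *+ 2 + hmF (hmE m) *+ 4)
}.

(** * Stability of the relations under left multiplication by [p] *)

Section RelationStep.
Variables (V : comPzRingType) (p f z t : V) (H E Q : {additive V -> V}).
Let C v := H (H v) + H v *+ 2 + (f * E v) *+ 4.
Hypothesis Hp : forall v, H (p * v) = p * H v - p * v.
Hypothesis Hf : forall v, H (f * v) = f * H v - (f * v) *+ 2.
Hypothesis Hz : forall v, H (z * v) = z * H v.
Hypothesis Ht : forall v, H (t * v) = t * H v.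
Hypothesis Ep : forall v, E (p * v) = p * E v + Q v.
Hypothesis Ez : forall v, E (z * v) = z * E v.
Hypothesis Et : forall v, E (t * v) = t * E v.
Hypothesis Qp : forall v, Q (p * v) = p * Q v + z * v + t * C v.

Definition sl2_rel v := E (f * v) = f * E v + H v /\
                        H (E v) = E (H v) + E v *+ 2.
Definition doublet_rel v := [/\ H (Q v) = Q (H v) + Q v,
   E (Q v) = Q (E v) & f * Q v = Q (f * v) + p * v].

Lemma rel_step v :
  sl2_rel v -> sl2_rel (E v) -> sl2_rel (H v) -> doublet_rel v ->
  sl2_rel (p * v) /\ doublet_rel (p * v).
Proof.
move=> [s1 s2] [e1 e2] [h1 h2] [d1 d2 d3].
split; [split|split].
- have -> : f * (p * v) = p * (f * v) by ring.
  (* [d3] is used backwards, as [Q (f * v) = f * Q v - p * v]. *)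
  by rewrite !Ep Hp s1 -[Q (f * v)](addrK (p * v)) -d3; ring.
- rewrite Hp Ep [H (_ + _)]raddfD [E (_ - _)]raddfB /= Hp !Ep s2 d1; ring.
- rewrite Hp Qp /C !(raddfD, raddfN, raddfMn) /= Hp !Qp d1 Hz Ht /C.
  rewrite !(raddfD, raddfMn, raddfN) /= Hf s2.
  ring.
- rewrite Ep !Qp /C !(raddfD, raddfN, raddfMn) /= !(Ep, Ez, Et) !Qp d2 /C.
  have h3 : E (H v) = H (E v) - E v *+ 2 by rewrite s2 addrK.
  have h4 : E (H (H v)) = H (E (H v)) - E (H v) *+ 2 by rewrite h2 addrK.
  rewrite !(raddfD, raddfN, raddfMn) /= e1 h4 h3 !(raddfD, raddfN, raddfMn) /=.
  ring.
- have -> : f * (p * v) = p * (f * v) by ring.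
  rewrite !Qp -[Q (f * v)](addrK (p * v)) -d3 /C Hf s1.
  rewrite !(raddfD, raddfN, raddfMn) /= !Hf.
  ring.
Qed.
End RelationStep.

Definition jf : 'I_5 := @Ordinal 5 0 isT.
Definition jq : 'I_5 := @Ordinal 5 1 isT.
Definition je : 'I_5 := @Ordinal 5 2 isT.
Definition jh : 'I_5 := @Ordinal 5 3 isT.
Definition jz : 'I_5 := @Ordinal 5 4 isT.

(** * The space of ordered monomials *)

(* The outer variable is [p], the inner one [t]; the variables of the
   coefficients are [f, q, e, h, z]. A monomial stands for the product of its
   factors in the order [p, t, f, q, e, h, z]. *)
Definition pbwt (K : fieldType) : Type := {poly {poly {mpoly K[5]}}}.
HB.instance Definition _ (K : fieldType) := GRing.ComNzRing.on (pbwt K).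

(** The locks keep these constants atomic for conversion and [ring], instead of unfolding to nested
    polynomials. *)
HB.lock Definition cstt (K : fieldType) (c : {mpoly K[5]}) : pbwt K :=
  (c%:P%:P : {poly {poly {mpoly K[5]}}}).
HB.lock Definition pv (K : fieldType) : pbwt K :=
  ('X : {poly {poly {mpoly K[5]}}}).
HB.lock Definition tv (K : fieldType) : pbwt K :=
  ('X%:P : {poly {poly {mpoly K[5]}}}).
HB.lock Definition bast (K : fieldType) (i r : nat) (c : {mpoly K[5]}) :
  pbwt K := pv K ^+ i * (tv K ^+ r * cstt c).
Arguments pv {K}.
Arguments tv {K}.

Section Pbwt.
Variable K : fieldType.
Local Notation V := {mpoly K[5]}.
Local Notation Ut := (pbwt K).

Fact cstt_is_zmod_morphism : zmod_morphism (@cstt K).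
Proof. by move=> a b; rewrite cstt.unlock !polyCB. Qed.
HB.instance Definition _ :=
  GRing.isZmodMorphism.Build V Ut (@cstt K) cstt_is_zmod_morphism.
Fact cstt_is_monoid_morphism : monoid_morphism (@cstt K).
Proof. by split=> [|a b]; rewrite cstt.unlock ?polyCM. Qed.
HB.instance Definition _ :=
  GRing.isMonoidMorphism.Build V Ut (@cstt K) cstt_is_monoid_morphism.

(** The native scaling of these polynomials is by the inner polynomial ring; the [K]-module
    structure goes through [cstt]. *)
Definition scalet (a : K) (v : Ut) : Ut := cstt a%:MP * v.

Fact scaletA a b v : scalet a (scalet b v) = scalet (a * b) v.
Proof. by rewrite /scalet mpolyCM rmorphM mulrA. Qed.
Fact scale1t : left_id 1 scalet.
Proof. by move=> v; rewrite /scalet mpolyC1 rmorph1 mul1r. Qed.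
Fact scaletDr : right_distributive scalet +%R.
Proof. by move=> a v w; rewrite /scalet mulrDr. Qed.
Fact scaletDl v : {morph scalet^~ v : a b / a + b}.
Proof. by move=> a b; rewrite /scalet mpolyCD rmorphD mulrDl. Qed.

HB.instance Definition _ :=
  GRing.Zmodule_isLmodule.Build K Ut scaletA scale1t scaletDr scaletDl.

Lemma scaletE a (v : Ut) : a *: v = cstt a%:MP * v. Proof. by []. Qed.

Lemma cstt_scale a c : cstt (a *: c) = a *: cstt c.
Proof. by rewrite scaletE -rmorphM mul_mpolyC. Qed.

Lemma bastE i r c : bast i r c = ((c *: 'X^r) *: 'X^i : {poly {poly V}}).
Proof.
rewrite bast.unlock pv.unlock tv.unlock cstt.unlock -polyC_exp -polyCM [_ *
  c%:P]mulrC mul_polyC.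
by rewrite mulrC mul_polyC.
Qed.

Lemma coef_bast i r c a b :
  (bast i r c : {poly {poly V}})`_a`_b = c *+ ((a == i) && (b == r)).
Proof.
rewrite bastE coefZ coefXn; case: eqP => _; last by rewrite mulr0 coef0.
by rewrite mulr1 coefZ coefXn; case: eqP => _; rewrite ?mulr1 ?mulr0.
Qed.

Lemma pbwtE (v : {poly {poly V}}) :
  v = \sum_(i < size v) \sum_(r < size v`_i) bast i r v`_i`_r :> Ut.
Proof.
rewrite -[LHS]coefK poly_def; apply: eq_bigr => i _.
rewrite -[X in X *: _]coefK poly_def scaler_suml.
by apply: eq_bigr => r _; rewrite bastE.
Qed.

(** The bound on [i] serves the arguments by degree in [p]: the estimates for [Hop] and [Eop], and
    [pbwt_rel]. *)
Lemma pbwt_size_ind (n : nat) (Pr : Ut -> Prop) :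
  Pr 0 -> (forall v w, Pr v -> Pr w -> Pr (v + w)) ->
  (forall i r c, (i < n)%N -> Pr (bast i r c)) ->
  forall v : Ut, (size (v : {poly {poly V}}) <= n)%N -> Pr v.
Proof.
move=> P0 PD Pb v sv; rewrite [v]pbwtE.
apply: (big_ind Pr) => // i _; apply: (big_ind Pr) => // r _.
by apply: Pb; apply: leq_trans sv.
Qed.

Lemma pbwt_ind (Pr : Ut -> Prop) :
  Pr 0 -> (forall v w, Pr v -> Pr w -> Pr (v + w)) ->
  (forall i r c, Pr (bast i r c)) -> forall v, Pr v.
Proof.
by move=> P0 PD Pb v; apply: (@pbwt_size_ind _ Pr P0 PD) (leqnn _) => i r c _.
Qed.

Section Ext.
Variables (M : lmodType K) (phi : nat -> nat -> {linear V -> M}).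

Definition ext (v : Ut) : M :=
  \sum_(i < size (v : {poly {poly V}}))
    \sum_(r < sizeY (v : {poly {poly V}})) phi i r (v : {poly {poly V}})`_i`_r.

(** Larger ranges only add zero coefficients, so several vectors can share one rectangle of indices;
    additivity of [ext] follows. *)
Lemma ext_widen n m (v : {poly {poly V}}) : (size v <= n)%N ->
  (sizeY v <= m)%N ->
  ext v = \sum_(i < n) \sum_(r < m) phi i r v`_i`_r.
Proof.
move=> sn sm; pose F i := \sum_(r < sizeY v) phi i r v`_i`_r.
rewrite -[ext v]/(\sum_(i < size v) F i) (big_ord_widen n F sn) big_mkcond /=.
apply: eq_bigr => i _; rewrite /F.
rewrite (big_ord_widen m (fun r => phi i r v`_i`_r) sm) big_mkcond /=.
case: ltnP => [_|szi].
  apply: eq_bigr => r _; case: ltnP => // szr.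
  by rewrite -coef_swapXY [(swapXY v)`_r]nth_default -?sizeYE ?coef0 ?raddf0.
by rewrite big1 // => r _; rewrite (nth_default 0 szi) coef0 raddf0.
Qed.

Fact ext_is_zmod_morphism : zmod_morphism ext.
Proof.
move=> v w; pose n := maxn (size (v : {poly {poly V}}))
  (maxn (size (w : {poly {poly V}})) (size (v - w : {poly {poly V}}))).
pose m := maxn (sizeY (v : {poly {poly V}}))
  (maxn (sizeY (w : {poly {poly V}})) (sizeY (v - w : {poly {poly V}}))).
rewrite !(@ext_widen n m) ?leq_max ?leqnn ?orbT // -sumrB.
apply: eq_bigr => i _; rewrite -sumrB; apply: eq_bigr => r _.
by rewrite !coefB raddfB.
Qed.
HB.instance Definition _ :=
  GRing.isZmodMorphism.Build Ut M ext ext_is_zmod_morphism.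

Lemma ext_bast i r c : ext (bast i r c) = phi i r c.
Proof.
pose n := maxn i.+1 (size (bast i r c : {poly {poly V}})).
pose m := maxn r.+1 (sizeY (bast i r c : {poly {poly V}})).
have ltin : (i < n)%N by rewrite leq_max leqnn.
have ltrm : (r < m)%N by rewrite leq_max leqnn.
rewrite (@ext_widen n m) ?leq_max ?leqnn ?orbT //.
rewrite (bigD1 (Ordinal ltin)) //= (bigD1 (Ordinal ltrm)) //=.
rewrite coef_bast !eqxx big1 => [|j nj]; last first.
  rewrite coef_bast eqxx /=; have /negPf -> : (j : nat) != r by [].
  by rewrite raddf0.
rewrite addr0 big1 ?addr0 // => j nj; apply: big1 => k _.
rewrite coef_bast; have /negPf -> : (j : nat) != i by [].
by rewrite raddf0.
Qed.

Fact ext_is_scalable : scalable ext.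
Proof.
move=> a; elim/pbwt_ind => [|v w IHv IHw|i r c].
- by rewrite scaler0 raddf0 scaler0.
- by rewrite scalerDr !raddfD /= IHv IHw.
- have -> : a *: bast i r c = bast i r (a *: c).
    by rewrite bast.unlock cstt_scale scaletE mulrCA [cstt _ * (_ * _)]mulrCA.
  by rewrite !ext_bast linearZZ.
Qed.
HB.instance Definition _ :=
  GRing.isScalable.Build K Ut M *:%R ext ext_is_scalable.

End Ext.

End Pbwt.

(** * Left multiplication by the generators *)

(* On ordered monomials in [f, q, e, h, z], [h0] and [e0] are the left
   multiplications by [h] and [e], and [h_bor] is that by [h] on the monomials
   without [f]. *)
HB.lock Definition h_bor (K : fieldType) (c : {mpoly K[5]}) : {mpoly K[5]} :=
  'X_jh * c + 'X_jq * c^`M(jq) + ('X_je * c^`M(je)) *+ 2.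
HB.lock Definition h0 (K : fieldType) (c : {mpoly K[5]}) : {mpoly K[5]} :=
  h_bor c - ('X_jf * c^`M(jf)) *+ 2.
HB.lock Definition e0 (K : fieldType) (c : {mpoly K[5]}) : {mpoly K[5]} :=
  'X_je * c + h_bor c^`M(jf) - 'X_jf * c^`M(jf)^`M(jf).

Section Operators.
Variable K : fieldType.
Local Notation V := {mpoly K[5]}.
Local Notation Ut := (pbwt K).
Local Notation "''f'" := ('X_jf : V).
Local Notation "''q'" := ('X_jq : V).
Local Notation "''e'" := ('X_je : V).
Local Notation "''h'" := ('X_jh : V).
Local Notation "''z'" := ('X_jz : V).

Lemma h_bor_linear : linear (@h_bor K).
Proof. by move=> a c d; rewrite h_bor.unlock !linearP /= -!mul_mpolyC;
  ring. Qed.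
HB.instance Definition _ := GRing.isLinear.Build K V V _ (@h_bor K)
  h_bor_linear.

Lemma h0_linear : linear (@h0 K).
Proof. by move=> a c d; rewrite h0.unlock !linearP /= -!mul_mpolyC; ring. Qed.
HB.instance Definition _ := GRing.isLinear.Build K V V _ (@h0 K) h0_linear.

Lemma e0_linear : linear (@e0 K).
Proof. by move=> a c d; rewrite e0.unlock !linearP /= -!mul_mpolyC; ring. Qed.
HB.instance Definition _ := GRing.isLinear.Build K V V _ (@e0 K) e0_linear.

Lemma mderivXU n (i j : 'I_n) : ('X_j : {mpoly K[n]})^`M(i) = (i == j)%:R.
Proof.
rewrite mderivX mnm1E eq_sym; case: eqP => [->|_]; last by rewrite scale0r.
rewrite scale1r (_ : (_ - _)%MM = 0%MM) ?mpolyX0 //.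
by apply/mnmP => k; rewrite mnmBE subnn mnm0E.
Qed.

Let comm_fq (c : V) : c^`M(jf)^`M(jq) = c^`M(jq)^`M(jf).
Proof. exact: mderiv_comm. Qed.
Let comm_fe (c : V) : c^`M(jf)^`M(je) = c^`M(je)^`M(jf).
Proof. exact: mderiv_comm. Qed.
Let comm_qe (c : V) : c^`M(jq)^`M(je) = c^`M(je)^`M(jq).
Proof. exact: mderiv_comm. Qed.
Let mderiv1 i : (1 : V)^`M(i) = 0.
Proof. by rewrite -mpolyC1 mderivC. Qed.
Let derivE := (mderivD, mderivN, mderivMn, mderivM, mderivXU, mderiv1).
Let commE := (comm_fq, comm_fe, comm_qe).

Lemma h0_f (c : V) : h0 ('f * c) = 'f * h0 c - ('f * c) *+ 2.
Proof. by rewrite h0.unlock h_bor.unlock !derivE /=; ring. Qed.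

Lemma h0_q (c : V) : h0 ('q * c) = 'q * h0 c + 'q * c.
Proof. by rewrite h0.unlock h_bor.unlock !derivE /=; ring. Qed.

Lemma h0_z (c : V) : h0 ('z * c) = 'z * h0 c.
Proof. by rewrite h0.unlock h_bor.unlock !derivE /=; ring. Qed.

Lemma h0_df (c : V) : h0 c^`M(jf) = (h0 c)^`M(jf) + c^`M(jf) *+ 2.
Proof. by rewrite h0.unlock h_bor.unlock !derivE /= !commE; ring. Qed.

Lemma e0_f (c : V) : e0 ('f * c) = 'f * e0 c + h0 c.
Proof. by rewrite e0.unlock h0.unlock h_bor.unlock !derivE /=; ring. Qed.

(** The extra term appears because [e] passing a factor [f] leaves an [h], which has weight 1 on
    [q]. *)
Lemma e0_q (c : V) : e0 ('q * c) = 'q * e0 c + 'q * c^`M(jf).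
Proof. by rewrite e0.unlock h_bor.unlock !derivE /=; ring. Qed.

Lemma e0_z (c : V) : e0 ('z * c) = 'z * e0 c.
Proof. by rewrite e0.unlock h_bor.unlock !derivE /=; ring. Qed.

Lemma e0_df (c : V) : e0 c^`M(jf) = (e0 c)^`M(jf) + c^`M(jf)^`M(jf).
Proof. by rewrite e0.unlock h_bor.unlock !derivE /= !commE; ring. Qed.

(** Each of the three terms of [e0] has weight 2: multiplication by [e] and derivation in [f] have
    weight 2, multiplication by [f] has weight -2, and [h_bor] commutes with [h0]. *)
Lemma h0_e0 (c : V) : h0 (e0 c) = e0 (h0 c) + e0 c *+ 2.
Proof.
have h0_e (d : V) : h0 ('e * d) = 'e * h0 d + ('e * d) *+ 2.
  by rewrite h0.unlock h_bor.unlock !derivE /=; ring.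
have h_bor_f (d : V) : h_bor ('f * d) = 'f * h_bor d.
  by rewrite h_bor.unlock !derivE /=; ring.
have h_bor_df (d : V) : (h_bor d)^`M(jf) = h_bor d^`M(jf).
  by rewrite h_bor.unlock !derivE /= !commE; ring.
have h_borB2 (x y : V) : h_bor (x - y *+ 2) = h_bor x - h_bor y *+ 2.
  by rewrite raddfB raddfMn.
have h0_h_bor (d : V) : h0 (h_bor d) = h_bor (h0 d).
  by rewrite h0.unlock h_borB2 h_bor_f -h_bor_df.
have df_h0 (d : V) : (h0 d)^`M(jf) = h0 d^`M(jf) - d^`M(jf) *+ 2.
  by rewrite h0_df addrK.
have h0DB (x y w : V) : h0 (x + y - w) = h0 x + h0 y - h0 w.
  by rewrite raddfB raddfD.
rewrite e0.unlock h0DB h0_e h0_h_bor h0_f !df_h0.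
rewrite mderivB mderivMn df_h0 h_borB2.
ring.
Qed.

(** Since [h p = p h - p], left multiplication by [h] sends [p^i c] to [p^i (hp i c)]. *)
Definition hp (i : nat) (c : V) : V := h0 c - c *+ i.

Fact hp_linear i : linear (hp i).
Proof.
move=> a c d; rewrite /hp linearP /= mulrnDl scalerBr scalerMnr opprD.
by rewrite addrACA.
Qed.
HB.instance Definition _ i := GRing.isLinear.Build K V V _ (hp i) (hp_linear i).

(* The values of [e] and [q] on [p^i c], obtained by moving one factor [p] to
   the left with [e p = p e + q] and [q p = p q + z + t C]. *)
Fixpoint eqrec (i : nat) (c : V) : Ut * Ut :=
  if i is j.+1 then
    let: (E, Q) := eqrec j c in
    (pv * E + Q,
     pv * Q + cstt 'z * (pv ^+ j * cstt c)
     + tv * (pv ^+ j * cstt (hp j (hp j c) + hp j c *+ 2)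
             + (cstt 'f * E) *+ 4))
  else (cstt (e0 c), cstt ('q * c) - pv * cstt c^`M(jf)).

Definition hphi (i r : nat) (c : V) : Ut := bast i r (hp i c).
Definition ephi (i r : nat) (c : V) : Ut := tv ^+ r * (eqrec i c).1.
Definition qphi (i r : nat) (c : V) : Ut := tv ^+ r * (eqrec i c).2.

Lemma scaletAr a (v w : Ut) : v * (a *: w) = a *: (v * w).
Proof. by rewrite !scaletE mulrCA. Qed.

Fact cstt_linear : linear (@cstt K).
Proof. by move=> a c d; rewrite rmorphD /= cstt_scale. Qed.

Fact bast_linear i r : linear (@bast K i r).
Proof.
by move=> a c d; rewrite bast.unlock cstt_linear !mulrDr !scaletAr.
Qed.
HB.instance Definition _ i r :=
  GRing.isLinear.Build K V Ut _ (@bast K i r) (bast_linear i r).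

Fact hphi_linear i r : linear (hphi i r).
Proof. by move=> a c d; rewrite /hphi !linearP. Qed.
HB.instance Definition _ i r :=
  GRing.isLinear.Build K V Ut _ (hphi i r) (hphi_linear i r).

Lemma eqrec_linear i a c d :
  eqrec i (a *: c + d) = (a *: (eqrec i c).1 + (eqrec i d).1,
                          a *: (eqrec i c).2 + (eqrec i d).2).
Proof.
elim: i => [|i IH].
  congr (_, _); first by rewrite linearP /= cstt_linear.
  rewrite /= mulrDr -scalerAr !linearP /= !cstt_linear.
  by rewrite mulrDr scaletAr scalerBr opprD addrACA.
rewrite [eqrec i.+1 _]/= IH /=.
case: (eqrec i c) (eqrec i d) => [E Q] [E' Q'] /=.
congr (_, _); first by rewrite mulrDr scaletAr scalerDr addrACA.
rewrite !hp_linear !raddfD !raddfMn /= !raddfD /= !cstt_scale !scaletE.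
ring.
Qed.

Fact ephi_linear i r : linear (ephi i r).
Proof. by move=> a c d; rewrite /ephi eqrec_linear mulrDr scaletAr. Qed.
HB.instance Definition _ i r :=
  GRing.isLinear.Build K V Ut _ (ephi i r) (ephi_linear i r).
Fact qphi_linear i r : linear (qphi i r).
Proof. by move=> a c d; rewrite /qphi eqrec_linear mulrDr scaletAr. Qed.
HB.instance Definition _ i r :=
  GRing.isLinear.Build K V Ut _ (qphi i r) (qphi_linear i r).

End Operators.

(** * The operators of [h], [e], [q] and their commutation with the other generators *)

HB.lock Definition Hop (K : fieldType) (v : pbwt K) : pbwt K := ext (@hphi K) v.
HB.lock Definition Eop (K : fieldType) (v : pbwt K) : pbwt K := ext (@ephi K) v.
HB.lock Definition Qop (K : fieldType) (v : pbwt K) : pbwt K := ext (@qphi K) v.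

Section Relations.
Variable K : fieldType.
Local Notation V := {mpoly K[5]}.
Local Notation Ut := (pbwt K).

Fact Hop_linear : linear (@Hop K).
Proof. by move=> a v w; rewrite Hop.unlock linearP. Qed.
HB.instance Definition _ := GRing.isLinear.Build K Ut Ut _ (@Hop K) Hop_linear.
Fact Eop_linear : linear (@Eop K).
Proof. by move=> a v w; rewrite Eop.unlock linearP. Qed.
HB.instance Definition _ := GRing.isLinear.Build K Ut Ut _ (@Eop K) Eop_linear.
Fact Qop_linear : linear (@Qop K).
Proof. by move=> a v w; rewrite Qop.unlock linearP. Qed.
HB.instance Definition _ := GRing.isLinear.Build K Ut Ut _ (@Qop K) Qop_linear.

Lemma Hop_bast i r (c : V) : Hop (bast i r c) = bast i r (hp i c).
Proof. by rewrite Hop.unlock ext_bast. Qed.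
Lemma Eop_bast i r (c : V) : Eop (bast i r c) = tv ^+ r * (eqrec i c).1.
Proof. by rewrite Eop.unlock ext_bast. Qed.
Lemma Qop_bast i r (c : V) : Qop (bast i r c) = tv ^+ r * (eqrec i c).2.
Proof. by rewrite Qop.unlock ext_bast. Qed.

Lemma pv_bast i r (c : V) : pv * bast i r c = bast i.+1 r c.
Proof. by rewrite bast.unlock exprS mulrA. Qed.
Lemma tv_bast i r (c : V) : tv * bast i r c = bast i r.+1 c.
Proof. by rewrite bast.unlock exprS [LHS]mulrCA -!mulrA. Qed.
Lemma cstt_bast i r (c d : V) : cstt d * bast i r c = bast i r (d * c).
Proof. by rewrite bast.unlock rmorphM mulrCA [cstt d * _]mulrCA. Qed.
Lemma bast00 (c : V) : bast 0 0 c = cstt c.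
Proof. by rewrite bast.unlock !mul1r. Qed.

Lemma Hop_pv v : Hop (pv * v) = pv * Hop v - pv * v :> Ut.
Proof.
elim/pbwt_ind: v => [|v w IHv IHw|i r c];
  first by rewrite !(mulr0, raddf0, subr0, mul0rn, addr0).
  by rewrite !(mulrDr, raddfD) /= IHv IHw; ring.
rewrite pv_bast !Hop_bast !pv_bast -raddfB /=; congr (bast _ _ _).
by rewrite /hp mulrS opprD addrCA addrC.
Qed.

Lemma Hop_tv v : Hop (tv * v) = tv * Hop v :> Ut.
Proof.
elim/pbwt_ind: v => [|v w IHv IHw|i r c];
  first by rewrite !(mulr0, raddf0, subr0, mul0rn, addr0).
  by rewrite !(mulrDr, raddfD) /= IHv IHw; ring.
by rewrite tv_bast !Hop_bast tv_bast.
Qed.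

Lemma Hop_z v : Hop (cstt 'X_jz * v) = cstt 'X_jz * Hop v :> Ut.
Proof.
elim/pbwt_ind: v => [|v w IHv IHw|i r c];
  first by rewrite !(mulr0, raddf0, subr0, mul0rn, addr0).
  by rewrite !(mulrDr, raddfD) /= IHv IHw; ring.
by rewrite cstt_bast !Hop_bast cstt_bast /hp h0_z mulrBr mulrnAr.
Qed.

Lemma Hop_f v :
  Hop (cstt 'X_jf * v) = cstt 'X_jf * Hop v - (cstt 'X_jf * v) *+ 2 :> Ut.
Proof.
elim/pbwt_ind: v => [|v w IHv IHw|i r c].
- by rewrite !(mulr0, raddf0, subr0, mul0rn, addr0).
- by rewrite !(mulrDr, raddfD) /= IHv IHw; ring.
rewrite !cstt_bast !Hop_bast cstt_bast -raddfMn -raddfB /=; congr (bast _ _ _).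
by rewrite /hp h0_f mulrBr mulrnAr addrAC.
Qed.

Lemma Eop_pv v : Eop (pv * v) = pv * Eop v + Qop v :> Ut.
Proof.
elim/pbwt_ind: v => [|v w IHv IHw|i r c];
  first by rewrite !(mulr0, raddf0, subr0, mul0rn, addr0).
  by rewrite !(mulrDr, raddfD) /= IHv IHw; ring.
rewrite pv_bast !Eop_bast Qop_bast /=.
by case: (eqrec i c) => E Q /=; ring.
Qed.

Lemma Eop_tv v : Eop (tv * v) = tv * Eop v :> Ut.
Proof.
elim/pbwt_ind: v => [|v w IHv IHw|i r c];
  first by rewrite !(mulr0, raddf0, subr0, mul0rn, addr0).
  by rewrite !(mulrDr, raddfD) /= IHv IHw; ring.
by rewrite tv_bast !Eop_bast exprS mulrA.
Qed.

Lemma Qop_tv v : Qop (tv * v) = tv * Qop v :> Ut.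
Proof.
elim/pbwt_ind: v => [|v w IHv IHw|i r c];
  first by rewrite !(mulr0, raddf0, subr0, mul0rn, addr0).
  by rewrite !(mulrDr, raddfD) /= IHv IHw; ring.
by rewrite tv_bast !Qop_bast exprS mulrA.
Qed.

(** This holds by construction: the recursion defining [eqrec] is this relation read on ordered
    monomials. *)
Lemma Qop_pv v : Qop (pv * v) = pv * Qop v + cstt 'X_jz * v
  + tv * (Hop (Hop v) + Hop v *+ 2 + (cstt 'X_jf * Eop v) *+ 4) :> Ut.
Proof.
elim/pbwt_ind: v => [|v w IHv IHw|i r c].
- by rewrite !(mulr0, raddf0, subr0, mul0rn, addr0).
- by rewrite !(mulrDr, raddfD) /= IHv IHw; ring.
rewrite pv_bast !Qop_bast Eop_bast /= !Hop_bast -raddfMn -raddfD /=.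
rewrite bast.unlock; case: (eqrec i c) => E Q /=; ring.
Qed.

Lemma eqrec_z i (c : V) : eqrec i ('X_jz * c) =
  (cstt 'X_jz * (eqrec i c).1, cstt 'X_jz * (eqrec i c).2).
Proof.
have hpz j (d : V) : hp j ('X_jz * d) = 'X_jz * hp j d.
  by rewrite /hp h0_z mulrBr mulrnAr.
elim: i => [|i IH] /=.
  rewrite e0_z rmorphM; congr (_, _).
  rewrite mderivM mderivXU mul0r add0r !rmorphM mulrBr /=.
  by congr (_ - _); rewrite mulrCA.
rewrite IH; case: (eqrec i c) => E Q /=; congr (_, _); first by ring.
by rewrite !hpz raddfD raddfMn /= [in RHS]raddfD raddfMn /= !rmorphM; ring.
Qed.

Lemma Eop_z v : Eop (cstt 'X_jz * v) = cstt 'X_jz * Eop v :> Ut.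
Proof.
elim/pbwt_ind: v => [|v w IHv IHw|i r c];
  first by rewrite !(mulr0, raddf0, subr0, mul0rn, addr0).
  by rewrite !(mulrDr, raddfD) /= IHv IHw; ring.
by rewrite cstt_bast !Eop_bast eqrec_z mulrCA.
Qed.

Lemma Qop_z v : Qop (cstt 'X_jz * v) = cstt 'X_jz * Qop v :> Ut.
Proof.
elim/pbwt_ind: v => [|v w IHv IHw|i r c];
  first by rewrite !(mulr0, raddf0, subr0, mul0rn, addr0).
  by rewrite !(mulrDr, raddfD) /= IHv IHw; ring.
by rewrite cstt_bast !Qop_bast eqrec_z mulrCA.
Qed.

End Relations.

(** * Verification of the remaining relations by induction on the degree in [p] *)

Section Relations2.
Variable K : fieldType.
Local Notation V := {mpoly K[5]}.
Local Notation Ut := (pbwt K).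

Definition pdeg_lt (n : nat) (v : Ut) : bool :=
  (size (v : {poly {poly V}}) <= n)%N.

Lemma pdeg_lt0 v : pdeg_lt 0 v -> v = 0.
Proof. by rewrite /pdeg_lt leqn0 size_poly_eq0 => /eqP. Qed.

Lemma pdeg_lt_zero n : pdeg_lt n 0.
Proof. by rewrite /pdeg_lt size_poly0. Qed.

Lemma pdeg_ltD n v w : pdeg_lt n v -> pdeg_lt n w -> pdeg_lt n (v + w).
Proof.
move=> nv nw; apply: leq_trans (size_polyD _ _) _.
by rewrite geq_max; apply/andP.
Qed.

Lemma pdeg_ltMn n v k : pdeg_lt n v -> pdeg_lt n (v *+ k).
Proof.
move=> nv; elim: k => [|k IH]; first exact: pdeg_lt_zero.
by rewrite mulrS; apply: pdeg_ltD.
Qed.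

Lemma pdeg_lt_pv n v : pdeg_lt n v -> pdeg_lt n.+1 (pv * v).
Proof.
move=> nv; rewrite /pdeg_lt pv.unlock; apply: leq_trans (size_polyMleq _ _) _.
by rewrite size_polyX.
Qed.

Lemma pdeg_lt_polyC n (a : {poly V}) v :
  pdeg_lt n v -> pdeg_lt n ((a%:P : {poly {poly V}}) * v : Ut).
Proof.
move=> nv; apply: leq_trans nv; rewrite mul_polyC; exact: size_scale_leq.
Qed.

Lemma pdeg_lt_cstt n c v : pdeg_lt n v -> pdeg_lt n (cstt c * v).
Proof. by move=> nv; rewrite cstt.unlock; apply: pdeg_lt_polyC. Qed.

Lemma pdeg_lt_tv n v : pdeg_lt n v -> pdeg_lt n (tv * v).
Proof. by move=> nv; rewrite tv.unlock; apply: pdeg_lt_polyC. Qed.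

Lemma pdeg_lt_tvX n r v : pdeg_lt n v -> pdeg_lt n (tv ^+ r * v).
Proof.
move=> nv; elim: r => [|r IH]; first by rewrite mul1r.
by rewrite exprS -mulrA; apply: pdeg_lt_tv.
Qed.

Lemma pdeg_lt_pvX n v : pdeg_lt 1 v -> pdeg_lt n.+1 (pv ^+ n * v).
Proof.
move=> nv; elim: n => [|n IH]; first by rewrite mul1r.
by rewrite exprS -mulrA; apply: pdeg_lt_pv.
Qed.

Lemma pdeg_lt_S n v : pdeg_lt n v -> pdeg_lt n.+1 v.
Proof. exact: leqW. Qed.

Lemma pdeg_lt_cst (c : V) : pdeg_lt 1 (cstt c).
Proof. by rewrite /pdeg_lt cstt.unlock; apply: size_polyC_leq1. Qed.

Lemma pdeg_lt_bast i r (c : V) : pdeg_lt i.+1 (bast i r c).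
Proof.
by rewrite bast.unlock; apply/pdeg_lt_pvX/pdeg_lt_tvX/pdeg_lt_cst.
Qed.

(** [e] does not raise the degree in [p], while [q] may raise it by one, because [q f = f q - p].
    The two bounds feed each other in the recursion. *)
Lemma pdeg_lt_eqrec i (c : V) :
  pdeg_lt i.+1 (eqrec i c).1 /\ pdeg_lt i.+2 (eqrec i c).2.
Proof.
elim: i => [|i [IHE IHQ]].
  split; first exact: pdeg_lt_cst.
  apply: pdeg_ltD; first exact/pdeg_lt_S/pdeg_lt_cst.
  by rewrite -mulrN -raddfN; apply/pdeg_lt_pv/pdeg_lt_cst.
rewrite /=; case: (eqrec i c) IHE IHQ => E Q /= IHE IHQ; split.
  by apply: pdeg_ltD => //; apply: pdeg_lt_pv.
apply: pdeg_ltD; first apply: pdeg_ltD.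
- exact: pdeg_lt_pv.
- by apply/pdeg_lt_S/pdeg_lt_S/pdeg_lt_cstt/pdeg_lt_pvX/pdeg_lt_cst.
- apply/pdeg_lt_S/pdeg_lt_S/pdeg_lt_tv/pdeg_ltD.
    exact/pdeg_lt_pvX/pdeg_lt_cst.
  exact/pdeg_ltMn/pdeg_lt_cstt.
Qed.

Lemma pdeg_lt_leq m n v : (m <= n)%N -> pdeg_lt m v -> pdeg_lt n v.
Proof. by move=> lemn nv; apply: leq_trans lemn. Qed.

Lemma pdeg_lt_Hop n v : pdeg_lt n v -> pdeg_lt n (Hop v).
Proof.
move: v; apply: pbwt_size_ind => [|v w IHv IHw|i r c ltin].
- by rewrite raddf0 pdeg_lt_zero.
- by rewrite raddfD pdeg_ltD.
- by rewrite Hop_bast; apply: pdeg_lt_leq (pdeg_lt_bast _ _ _).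
Qed.

Lemma pdeg_lt_Eop n v : pdeg_lt n v -> pdeg_lt n (Eop v).
Proof.
move: v; apply: pbwt_size_ind => [|v w IHv IHw|i r c ltin].
- by rewrite raddf0 pdeg_lt_zero.
- by rewrite raddfD pdeg_ltD.
rewrite Eop_bast; apply/pdeg_lt_tvX; apply: pdeg_lt_leq ltin _.
by case: (pdeg_lt_eqrec i c).
Qed.

Local Notation srel := (sl2_rel (cstt 'X_jf) (@Hop K) (@Eop K)).
Local Notation drel :=
  (doublet_rel pv (cstt 'X_jf) (@Hop K) (@Eop K) (@Qop K)).

Lemma Hop_cstt (c : V) : Hop (cstt c) = cstt (h0 c).
Proof. by rewrite -!bast00 Hop_bast /hp mulr0n subr0. Qed.
Lemma Eop_cstt (c : V) : Eop (cstt c) = cstt (e0 c).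
Proof. by rewrite -bast00 Eop_bast mul1r. Qed.
(** Moving [q] past a power of [f] by [q f = f q - p] produces the derivative in [f] and the factor
    [p]. *)
Lemma Qop_cstt (c : V) :
  Qop (cstt c) = cstt ('X_jq * c) - pv * cstt c^`M(jf).
Proof. by rewrite -bast00 Qop_bast mul1r. Qed.

Lemma rel_cstt (c : V) : srel (cstt c) /\ drel (cstt c).
Proof.
rewrite /sl2_rel /doublet_rel /= !Hop_cstt !Eop_cstt !Qop_cstt !raddfB /=.
rewrite Hop_pv Eop_pv -!rmorphM /= !Hop_cstt !Eop_cstt !Qop_cstt.
split; split.
- by rewrite e0_f rmorphD.
- by rewrite h0_e0 raddfD raddfMn.
- by rewrite h0_q h0_df !(raddfD, raddfMn) /=; ring.
- by rewrite e0_q e0_df !(raddfD, raddfMn) /=; ring.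
- by rewrite mderivM mderivXU /= mul1r raddfD /= !rmorphM; ring.
Qed.

Lemma rel_tv (v : Ut) : srel v /\ drel v -> srel (tv * v) /\ drel (tv * v).
Proof.
rewrite /sl2_rel /doublet_rel /=.
rewrite [cstt _ * (tv * v)]mulrCA !(Hop_tv, Eop_tv, Qop_tv).
case=> [[-> ->] [-> -> d]]; rewrite -[Qop (_ * v)](addrK (pv * v)) -d.
by do ![split]; ring.
Qed.

(** Factoring out one [p] leads to [rel_step]; its hypotheses at [Eop v] and [Hop v] come from the
    induction hypothesis, as neither operator raises the degree in [p]. *)
Lemma pbwt_rel (v : Ut) : srel v /\ drel v.
Proof.
have [n] : exists n, pdeg_lt n v by exists (size (v : {poly {poly V}}));
  apply: leqnn.
elim: n v => [|n IH]; move=> v.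
  move/pdeg_lt0 => ->.
  by rewrite /sl2_rel /doublet_rel /= !(mulr0, raddf0) !mul0rn !addr0.
move: v; apply: pbwt_size_ind => [|v w IHv IHw|[|i] r c ltin].
- by rewrite /sl2_rel /doublet_rel /= !(mulr0, raddf0) !mul0rn !addr0.
- case: IHv IHw => [[a1 a2] [a3 a4 a5]] [[b1 b2] [b3 b4 b5]].
  rewrite /sl2_rel /doublet_rel /= !(mulrDr, raddfD) /= a1 a2 a3 a4 a5 b1 b2
    b3 b4 b5.
  by do ![split]; ring.
(* In degree 0 in [p], a second induction runs on the power of [t]. *)
- rewrite bast.unlock mul1r; elim: r => [|r IHr].
    by rewrite mul1r; apply: rel_cstt.
  by rewrite exprS -mulrA; apply: rel_tv.
- rewrite -pv_bast.
  have nv : pdeg_lt n (bast i r c) by apply: pdeg_lt_leq (pdeg_lt_bast _ _ _).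
  have [s d] := IH _ nv.
  have [sE _] := IH _ (pdeg_lt_Eop nv).
  have [sH _] := IH _ (pdeg_lt_Hop nv).
  apply: (@rel_step _ _ _ (cstt 'X_jz) tv) => // u.
  + exact: Hop_pv.
  + exact: Hop_f.
  + exact: Hop_z.
  + exact: Hop_tv.
  + exact: Eop_pv.
  + exact: Eop_z.
  + exact: Eop_tv.
  + exact: Qop_pv.
Qed.

Definition mult (a v : Ut) : Ut := a * v.
Fact mult_linear a : linear (mult a).
Proof. by move=> b v w; rewrite /mult mulrDr scaletAr. Qed.
HB.instance Definition _ a :=
  GRing.isLinear.Build K Ut Ut _ (mult a) (mult_linear a).

(** Transparent, so that [hm_op] and [gent] compute to [Hop], [Eop], [Qop] and multiplications. *)
Definition pbwt_module : hecke_module Ut.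
Proof.
apply: (@HeckeModule K Ut (mult pv) (mult (cstt 'X_jf)) (@Qop K) (@Eop K)
  (@Hop K) (mult (cstt 'X_jz)) (mult tv)); rewrite /mult /=.
- by move=> m; exact: mulrCA.
- by move=> m; exact: mulrCA.
- by move=> m; exact/esym/Qop_z.
- by move=> m; exact/esym/Eop_z.
- by move=> m; exact/esym/Hop_z.
- by move=> m; exact: mulrCA.
- by move=> m; exact: mulrCA.
- by move=> m; exact/esym/Qop_tv.
- by move=> m; exact/esym/Eop_tv.
- by move=> m; exact/esym/Hop_tv.
- by move=> m; exact: mulrCA.
- by move=> m; exact: mulrCA.
- exact: Hop_pv.
- exact: Hop_f.
- by move=> m; have [_ []] := pbwt_rel m.
- by move=> m; have [[]] := pbwt_rel m.
- exact: Eop_pv.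
- by move=> m; have [[]] := pbwt_rel m.
- by move=> m; have [_ []] := pbwt_rel m.
- by move=> m; have [_ []] := pbwt_rel m.
- exact: Qop_pv.
Defined.

End Relations2.

(** * The action of ordered monomials on a module *)

Lemma mulX_mderivX (K : fieldType) (i : 'I_5) (m : 'X_{1..5}) :
  'X_i * 'X_[m]^`M(i) = 'X_[m] *+ m i :> {mpoly K[5]}.
Proof.
rewrite mderivX -scalerAr -mpolyXD scaler_nat.
case: (posnP (m i)) => [->|mi]; first by rewrite !mulr0n.
congr (_ *+ _); congr 'X_[_]; apply/mnmP => j.
rewrite mnmDE mnmBE mnm1E; case: eqP => [<-|_]; last by rewrite subn0.
by rewrite subnKC.
Qed.

Section Act.
Variables (K : fieldType) (M : lmodType K) (D : hecke_module M).
Local Notation V := {mpoly K[5]}.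
Local Notation Ut := (pbwt K).
Local Notation P := (hmP D).
Local Notation F := (hmF D).
Local Notation Q := (hmQ D).
Local Notation E := (hmE D).
Local Notation H := (hmH D).
Local Notation Z := (hmZ D).
Local Notation T := (hmT D).

Lemma iter_comm (f g : M -> M) n x :
  (forall y, f (g y) = g (f y)) -> f (iter n g x) = iter n g (f x).
Proof. by move=> fg; elim: n => //= n IH; rewrite fg IH. Qed.

Lemma iter_linear (f : {linear M -> M}) n : linear (iter n f).
Proof. by move=> a x y; elim: n => //= n ->; rewrite linearP. Qed.

Lemma iterD (f : {linear M -> M}) n x y :
  iter n f (x + y) = iter n f x + iter n f y.
Proof. by have := iter_linear f n 1 x y; rewrite !scale1r. Qed.
Lemma iterB (f : {linear M -> M}) n x y :
  iter n f (x - y) = iter n f x - iter n f y.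
Proof.
by rewrite addrC -scaleN1r iter_linear scaleN1r addrC.
Qed.
Lemma iterMn (f : {linear M -> M}) n x k : iter n f (x *+ k) = iter n f x *+ k.
Proof. by elim: n => //= n ->; rewrite raddfMn. Qed.

Definition monact (m : 'X_{1..5}) (x : M) : M :=
  iter (m jf) F (iter (m jq) Q (iter (m je) E (iter (m jh) H
    (iter (m jz) Z x)))).

Definition cact (x : M) (c : V) : M :=
  \sum_(m <- msupp c) c@_m *: monact m x.

(** Linearity in [c] compares sums over different supports; this puts them over a common list. *)
Lemma cactwE x c (s : seq 'X_{1..5}) : uniq s -> {subset msupp c <= s} ->
  cact x c = \sum_(m <- s) c@_m *: monact m x.
Proof.
move=> us sub; rewrite (bigID (mem (msupp c))) /= [X in _ + X]big1 ?addr0.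
  rewrite -big_filter; apply: perm_big; apply: uniq_perm.
  - exact: msupp_uniq.
  - exact: filter_uniq.
  by move=> m; rewrite mem_filter; case: (boolP (m \in _)) => // /sub ->.
by move=> m; rewrite -mcoeff_eq0 => /eqP ->; rewrite scale0r.
Qed.

Fact cact_linear x : linear (cact x).
Proof.
move=> a c d; pose s := undup (msupp c ++ msupp d ++ msupp (a *: c + d)).
have us : uniq s by apply: undup_uniq.
rewrite !(@cactwE x _ s us); first last.
- by move=> m mc; rewrite mem_undup !mem_cat mc ?orbT.
- by move=> m mc; rewrite mem_undup !mem_cat mc ?orbT.
- by move=> m mc; rewrite mem_undup !mem_cat mc ?orbT.
rewrite scaler_sumr -big_split; apply: eq_bigr => m _ /=.
by rewrite mcoeffD mcoeffZ scalerDl scalerA.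
Qed.
HB.instance Definition _ x := GRing.isLinear.Build K V M _ (cact x)
  (cact_linear x).

Lemma cactX x m : cact x 'X_[m] = monact m x.
Proof. by rewrite /cact msuppX big_seq1 mcoeffX eqxx scale1r. Qed.

Lemma mpoly_lin_ind (Pr : V -> Prop) :
  (forall a c d, Pr c -> Pr d -> Pr (a *: c + d)) -> Pr 0 ->
  (forall m, Pr 'X_[m]) -> forall c, Pr c.
Proof. by move=> PD P0 PX; apply: mpolyind => // a m c _ _; apply: PD. Qed.

Let iterFH n y : H (iter n F y) = iter n F (H y) - iter n F y *+ (n * 2).
Proof.
elim: n => [|n IH] /=; first by rewrite subr0.
by rewrite hmHF IH raddfB raddfMn /= -addrA -opprD -mulrnDr mulSn addnC.
Qed.
Let iterQH n y : H (iter n Q y) = iter n Q (H y) + iter n Q y *+ n.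
Proof.
elim: n => [|n IH] /=; first by rewrite addr0.
by rewrite hmHQ IH raddfD raddfMn /= -addrA -mulrSr.
Qed.
Let iterEH n y : H (iter n E y) = iter n E (H y) + iter n E y *+ (n * 2).
Proof.
elim: n => [|n IH] /=; first by rewrite addr0.
by rewrite hmHE IH raddfD raddfMn /= -addrA -mulrnDr mulSn addnC.
Qed.
(** The classical sl2 formula for the commutator of [e] with a power of [f]; it matches the terms of
    [e0] with derivatives in [f]. *)
Let iterFE n y : E (iter n.+1 F y) =
  iter n.+1 F (E y) + (iter n F (H y) - iter n F y *+ n) *+ n.+1.
Proof.
elim: n => [|n IH].
  by rewrite /= hmEF subr0.
rewrite [iter n.+2 F y]/= hmEF -[F (iter n F y)]/(iter n.+1 F y) IH iterFH.
rewrite raddfD raddfMn raddfB raddfMn /= -addrA; congr (_ + _).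
rewrite !mulrnBl -!mulrnA addrACA -mulrSr -opprD -mulrnDr.
(* The multiplicities agree by [n(n+1) + 2(n+1) = (n+1)(n+2)]. *)
by congr (_ - _ *+ _); lia.
Qed.
Let iterFQ n y : Q (iter n.+1 F y) = iter n.+1 F (Q y) - P (iter n F y) *+ n.+1.
Proof.
elim: n => [|n IH].
  by rewrite /= hmFQ addrK.
rewrite [iter n.+2 F y]/= -[Q (F _)](addrK (P (iter n.+1 F y))) -hmFQ IH.
by rewrite raddfB raddfMn /= hmFP -addrA -opprD -mulrSr.
Qed.

Lemma monactD_f m x : monact (U_(jf) + m) x = F (monact m x).
Proof. by rewrite /monact !mnmDE !mnm1E. Qed.

Lemma cact_f x c : cact x ('X_jf * c) = F (cact x c).
Proof.
elim/mpoly_lin_ind: c => [a c d IHc IHd||m].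
- by rewrite mulrDr -scalerAr !linearP /= IHc IHd.
- by rewrite mulr0 !raddf0.
- by rewrite -mpolyXD !cactX monactD_f.
Qed.

Lemma cact_z x c : cact x ('X_jz * c) = Z (cact x c).
Proof.
elim/mpoly_lin_ind: c => [a c d IHc IHd||m].
- by rewrite mulrDr -scalerAr !linearP /= IHc IHd.
- by rewrite mulr0 !raddf0.
rewrite -mpolyXD !cactX /monact !mnmDE !mnm1E /=.
rewrite (iter_comm _ _ (hmZF D)) (iter_comm _ _ (hmZQ D)).
by rewrite (iter_comm _ _ (hmZE D)) (iter_comm _ _ (hmZH D)).
Qed.

Lemma h0X m : h0 'X_[m] = 'X_[U_(jh) + m] + 'X_[m] *+ m jq
  + 'X_[m] *+ (m je * 2) - 'X_[m] *+ (m jf * 2) :> V.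
Proof.
by rewrite h0.unlock h_bor.unlock -mpolyXD !mulX_mderivX -!mulrnA.
Qed.

Lemma h_borX m : h_bor 'X_[m] = 'X_[U_(jh) + m] + 'X_[m] *+ m jq
  + 'X_[m] *+ (m je * 2) :> V.
Proof. by rewrite h_bor.unlock -mpolyXD !mulX_mderivX -!mulrnA. Qed.

Let H_bor (m : 'X_{1..5}) x (y := iter (m jq) Q (iter (m je) E (iter (m jh) H
    (iter (m jz) Z x)))) :
  H y = iter (m jq) Q (iter (m je) E (iter (m jh).+1 H (iter (m jz) Z x)))
    + y *+ m jq + y *+ (m je * 2).
Proof. by rewrite /y iterQH iterEH iterD iterMn addrAC. Qed.

Lemma cact_h0 x c : cact x (h0 c) = H (cact x c).
Proof.
elim/mpoly_lin_ind: c => [a c d IHc IHd||m].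
- by rewrite !linearP /= IHc IHd.
- by rewrite !raddf0.
rewrite h0X raddfB !raddfD !raddfMn /= !cactX [in RHS]/monact iterFH H_bor.
by rewrite !iterD !iterMn /monact !mnmDE !mnm1E ?mulNrn.
Qed.

Lemma mnm_pred (m : 'X_{1..5}) i :
  (0 < m i)%N -> exists m', m = (U_(i) + m')%MM.
Proof.
move=> mi; exists (m - U_(i))%MM.
apply/mnmP => j; rewrite mnmDE mnmBE mnm1E.
by case: eqP => [<-|_]; rewrite ?subnKC ?subn0.
Qed.

Lemma mderivXS i (m : 'X_{1..5}) :
  'X_[U_(i) + m]^`M(i) = 'X_[m] *+ (m i).+1 :> V.
Proof.
rewrite mderivX mnmDE mnm1E eqxx scaler_nat; congr ('X_[_] *+ _).
by apply/mnmP => j; rewrite mnmBE mnmDE addKn.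
Qed.

Lemma mderivX0 i (m : 'X_{1..5}) : m i = 0%N -> 'X_[m]^`M(i) = 0 :> V.
Proof. by rewrite mderivX => ->; rewrite scale0r. Qed.

Lemma cact_e0 x c : cact x (e0 c) = E (cact x c).
Proof.
elim/mpoly_lin_ind: c => [a c d IHc IHd||m].
- by rewrite !linearP /= IHc IHd.
- by rewrite !raddf0.
(* [iterFE] concerns positive powers of [f], so exponent 0 is treated apart. *)
case: (posnP (m jf)) => [m0|/mnm_pred[m' ->]].
  rewrite e0.unlock mderivX0 // !raddf0 mulr0 subr0 addr0 -mpolyXD !cactX.
  rewrite /monact !mnmDE !mnm1E m0 /=.
  by rewrite (iter_comm _ _ (hmEQ D)).
rewrite e0.unlock mderivXS !raddfMn /= mulrnAr mulX_mderivX -mpolyXD.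
rewrite -addrA -mulrnBl h_borX raddfD raddfMn raddfB !raddfD !raddfMn /= !cactX.
rewrite [in RHS]/monact !mnmDE !mnm1E -[(true + m' jf)%N]/(m' jf).+1.
rewrite !add0n iterFE H_bor !iterD !iterMn (iter_comm _ _ (hmEQ D)).
by rewrite /monact !mnmDE !mnm1E mulNrn.
Qed.

Lemma cact_q x c : cact x ('X_jq * c) - P (cact x c^`M(jf)) = Q (cact x c).
Proof.
elim/mpoly_lin_ind: c => [a c d IHc IHd||m].
- by rewrite mulrDr -scalerAr !linearP /= -IHc -IHd addrACA -scalerDr.
- by rewrite mulr0 !raddf0 addr0.
case: (posnP (m jf)) => [m0|/mnm_pred[m' ->]].
  rewrite mderivX0 // !raddf0 addr0 -mpolyXD !cactX.
  by rewrite /monact !mnmDE !mnm1E m0.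
rewrite mderivXS raddfMn -mpolyXD raddfMn /= !cactX.
rewrite [in RHS]/monact !mnmDE !mnm1E -[(true + m' jf)%N]/(m' jf).+1.
rewrite !add0n iterFQ.
by rewrite /monact !mnmDE !mnm1E.
Qed.

End Act.

Section Actphi.
Variables (K : fieldType) (M : lmodType K) (D : hecke_module M).
Definition actphi (x : M) (i r : nat) (c : {mpoly K[5]}) : M :=
  iter i (hmP D) (iter r (hmT D) (cact D x c)).

Fact actphi_linear x i r : linear (actphi x i r).
Proof. by move=> a c d; rewrite /actphi linearP !iter_linear. Qed.
HB.instance Definition _ x i r :=
  GRing.isLinear.Build K {mpoly K[5]} M _ (actphi x i r) (actphi_linear x i r).
End Actphi.

(** The vector [x] precedes the element [v] applied to it, since the map is a linear extension in
    [v]. *)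
HB.lock Definition act (K : fieldType) (M : lmodType K) (D : hecke_module M)
  (x : M) (v : pbwt K) : M := ext (actphi D x) v.

Section Act2.
Variables (K : fieldType) (M : lmodType K) (D : hecke_module M).
Local Notation V := {mpoly K[5]}.
Local Notation Ut := (pbwt K).
Local Notation P := (hmP D).
Local Notation F := (hmF D).
Local Notation Q := (hmQ D).
Local Notation E := (hmE D).
Local Notation H := (hmH D).
Local Notation Z := (hmZ D).
Local Notation T := (hmT D).

Fact act_linear x : linear (act D x).
Proof. by move=> a v w; rewrite act.unlock linearP. Qed.
HB.instance Definition _ x :=
  GRing.isLinear.Build K Ut M _ (act D x) (act_linear x).

Lemma act_bast x i r c :
  act D x (bast i r c) = iter i P (iter r T (cact D x c)).
Proof. by rewrite act.unlock ext_bast. Qed.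

Lemma act_P x v : act D x (pv * v) = P (act D x v).
Proof.
elim/pbwt_ind: v => [|v w IHv IHw|i r c]; first by rewrite mulr0 !raddf0.
  by rewrite mulrDr !raddfD /= IHv IHw.
by rewrite pv_bast !act_bast.
Qed.

Lemma act_T x v : act D x (tv * v) = T (act D x v).
Proof.
elim/pbwt_ind: v => [|v w IHv IHw|i r c]; first by rewrite mulr0 !raddf0.
  by rewrite mulrDr !raddfD /= IHv IHw.
by rewrite tv_bast !act_bast (iter_comm _ _ (hmTP D)).
Qed.

Lemma act_Z x v : act D x (cstt 'X_jz * v) = Z (act D x v).
Proof.
elim/pbwt_ind: v => [|v w IHv IHw|i r c]; first by rewrite mulr0 !raddf0.
  by rewrite mulrDr !raddfD /= IHv IHw.
have ZT y : Z (T y) = T (Z y) by rewrite hmTZ.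
by rewrite cstt_bast !act_bast (iter_comm _ _ (hmZP D)) (iter_comm _ _ ZT)
  cact_z.
Qed.

Lemma act_F x v : act D x (cstt 'X_jf * v) = F (act D x v).
Proof.
elim/pbwt_ind: v => [|v w IHv IHw|i r c]; first by rewrite mulr0 !raddf0.
  by rewrite mulrDr !raddfD /= IHv IHw.
have FT y : F (T y) = T (F y) by rewrite hmTF.
by rewrite cstt_bast !act_bast (iter_comm _ _ (hmFP D)) (iter_comm _ _ FT)
  cact_f.
Qed.

Lemma iterPH n y : H (iter n P y) = iter n P (H y) - iter n P y *+ n.
Proof.
elim: n => [|n IH] /=; first by rewrite subr0.
by rewrite hmHP IH raddfB raddfMn /= -addrA -opprD -mulrSr.
Qed.

Lemma act_H x v : act D x (Hop v) = H (act D x v).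
Proof.
elim/pbwt_ind: v => [|v w IHv IHw|i r c]; first by rewrite !raddf0.
  by rewrite !raddfD /= IHv IHw.
have HT y : H (T y) = T (H y) by rewrite hmTH.
rewrite Hop_bast !act_bast iterPH (iter_comm _ _ HT).
by rewrite /hp -cact_h0 raddfB raddfMn /= !iterB !iterMn.
Qed.

Lemma act_TX x r v : act D x (tv ^+ r * v) = iter r T (act D x v).
Proof.
by elim: r => [|r IH]; rewrite ?mul1r // exprS -mulrA act_T IH.
Qed.

Lemma act_pv_cstt x i c : act D x (pv ^+ i * cstt c) = iter i P (cact D x c).
Proof. by rewrite -(act_bast x i 0) bast.unlock mul1r. Qed.

(** The action turns the recursion of [eqrec] into the module relations [hmEP] and [hmQP]; both
    components are proved together because they call each other. *)
Lemma act_eqrec x i c :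
  act D x (eqrec i c).1 = E (iter i P (cact D x c)) /\
  act D x (eqrec i c).2 = Q (iter i P (cact D x c)).
Proof.
elim: i => [|i]; rewrite /=.
  have actC d : act D x (cstt d) = cact D x d by rewrite -bast00 act_bast.
  by split; rewrite ?raddfB /= ?act_P !actC ?cact_e0 ?cact_q.
case: (eqrec i c) => e q /= [IHe IHq].
split; first by rewrite raddfD /= act_P IHe IHq hmEP.
rewrite 2!raddfD /= act_P IHq act_Z act_T hmQP act_pv_cstt.
congr (_ + _ + _); congr (T _).
rewrite raddfD /= raddfMn /= act_F IHe; congr (_ + _).
have b0 d : pv ^+ i * cstt d = bast i 0 d :> Ut by rewrite bast.unlock mul1r.
(* [hp i] is recognized as [Hop] on [p^i c], so that [act_H] applies. *)
rewrite b0 raddfD raddfMn /= -!Hop_bast raddfD raddfMn /= !act_H.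
by rewrite act_bast.
Qed.

Lemma act_E x v : act D x (Eop v) = E (act D x v).
Proof.
elim/pbwt_ind: v => [|v w IHv IHw|i r c]; first by rewrite !raddf0.
  by rewrite !raddfD /= IHv IHw.
rewrite Eop_bast act_TX act_bast; case: (act_eqrec x i c) => -> _.
have ET y : E (T y) = T (E y) by rewrite hmTE.
have PT y : iter r T (P y) = P (iter r T y).
  by rewrite -(iter_comm _ _ (fun u => esym (hmTP D u))).
by rewrite -(iter_comm _ _ ET) (iter_comm _ _ PT).
Qed.

Lemma act_Q x v : act D x (Qop v) = Q (act D x v).
Proof.
elim/pbwt_ind: v => [|v w IHv IHw|i r c]; first by rewrite !raddf0.
  by rewrite !raddfD /= IHv IHw.
rewrite Qop_bast act_TX act_bast; case: (act_eqrec x i c) => _ ->.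
have QT y : Q (T y) = T (Q y) by rewrite hmTQ.
have PT y : iter r T (P y) = P (iter r T y).
  by rewrite -(iter_comm _ _ (fun u => esym (hmTP D u))).
by rewrite -(iter_comm _ _ QT) (iter_comm _ _ PT).
Qed.

Lemma act_1 x : act D x 1 = x.
Proof.
have -> : (1 : Ut) = bast 0 0 1 by rewrite bast00 rmorph1.
by rewrite act_bast -mpolyX0 cactX /monact !mnm0E.
Qed.

End Act2.

(** The action of a monomial is an iterate of the generating operators, so commuting with those is
    enough. Applied to well-chosen [psi], this yields associativity, [t]-linearity and the universal
    property. *)
Lemma act_intertwine (K : fieldType) (M M' : lmodType K) (D : hecke_module M)
    (D' : hecke_module M') (psi : {linear M -> M'}) :
  (forall x, psi (hmP D x) = hmP D' (psi x)) ->
  (forall x, psi (hmF D x) = hmF D' (psi x)) ->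
  (forall x, psi (hmQ D x) = hmQ D' (psi x)) ->
  (forall x, psi (hmE D x) = hmE D' (psi x)) ->
  (forall x, psi (hmH D x) = hmH D' (psi x)) ->
  (forall x, psi (hmZ D x) = hmZ D' (psi x)) ->
  (forall x, psi (hmT D x) = hmT D' (psi x)) ->
  forall x v, psi (act D x v) = act D' (psi x) v.
Proof.
move=> psiP psiF psiQ psiE psiH psiZ psiT x.
have it (f : M -> M) (f' : M' -> M') n y :
    (forall u, psi (f u) = f' (psi u)) -> psi (iter n f y) = iter n f' (psi y).
  by move=> ff'; elim: n => //= n IH; rewrite ff' IH.
elim/pbwt_ind => [|v w IHv IHw|i r c]; first by rewrite !raddf0.
  by rewrite !raddfD /= IHv IHw.
rewrite !act_bast (it _ _ i _ psiP) (it _ _ r _ psiT).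
congr (iter i _ (iter r _ _)).
elim/mpoly_lin_ind: c => [a c d IHc IHd||m].
- by rewrite !linearP /= IHc IHd.
- by rewrite !raddf0.
rewrite !cactX /monact (it _ _ _ _ psiF) (it _ _ _ _ psiQ) (it _ _ _ _ psiE).
by rewrite (it _ _ _ _ psiH) (it _ _ _ _ psiZ).
Qed.

(** * The associative product of [U_t] *)

Section Product.
Variable K : fieldType.
Local Notation V := {mpoly K[5]}.
Local Notation Ut := (pbwt K).

Definition prodt (v w : Ut) : Ut := act (pbwt_module K) w v.

(** [act D x] is itself a module map from the regular module to [M]. Associativity of [prodt] is the
    case where [M] is the regular module. *)
Lemma act_prodt (M : lmodType K) (D : hecke_module M) x v w :
  act D x (prodt v w) = act D (act D x w) v.
Proof.
rewrite /prodt; apply: (@act_intertwine _ _ _ _ _ (act D x)) => {}w.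
- exact: act_P.
- exact: act_F.
- exact: act_Q.
- exact: act_E.
- exact: act_H.
- exact: act_Z.
- exact: act_T.
Qed.

Lemma prodtA u v w : prodt u (prodt v w) = prodt (prodt u v) w.
Proof. by rewrite /prodt -act_prodt. Qed.

Lemma prod1t v : prodt 1 v = v. Proof. exact: act_1. Qed.

(** Rebuilding a monomial from 1 applies [z], [h], [e], [q], [f], [t], [p] in this order. Each
    operator then only raises its own exponent, as the factors it would have to cross are still
    absent. *)
Lemma prodt1 v : prodt v 1 = v.
Proof.
rewrite /prodt.
elim/pbwt_ind: v => [|v w IHv IHw|i r c]; first by rewrite raddf0.
  by rewrite raddfD /= IHv IHw.
have itm a n (y : Ut) : iter n (mult a) y = a ^+ n * y.
  by elim: n => [|n IH]; rewrite ?mul1r //= IH /mult exprS mulrA.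
rewrite act_bast /= !itm bast.unlock; congr (_ * (_ * _)).
elim/mpoly_lin_ind: c => [a c d IHc IHd||m].
- by rewrite linearP /= IHc IHd cstt_linear.
- by rewrite !raddf0.
rewrite cactX /monact /= !itm mulr1 -!rmorphXn /= !mpolyXn.
have itH n (k : 'X_{1..5}) : k jf = 0%N -> k jq = 0%N -> k je = 0%N ->
    iter n (@Hop K) (cstt 'X_[k]) = cstt 'X_[U_(jh) *+ n + k].
  move=> kf kq ke; elim: n => [|n IH] /=; first by rewrite mulm0n add0m.
  rewrite IH Hop_cstt h0X !mnmDE !mulmnE !mnm1E kf kq ke /= !(mul0n, addn0,
    mulr0n).
  by rewrite subr0 !addr0 mulmS addmA.
have itE n (k : 'X_{1..5}) : k jf = 0%N ->
    iter n (@Eop K) (cstt 'X_[k]) = cstt 'X_[U_(je) *+ n + k].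
  move=> kf; elim: n => [|n IH] /=; first by rewrite mulm0n add0m.
  rewrite IH Eop_cstt e0.unlock mderivX0; last first.
    by rewrite mnmDE mulmnE mnm1E kf.
  by rewrite !raddf0 mulr0 subr0 addr0 -mpolyXD mulmS addmA.
have itQ n (k : 'X_{1..5}) : k jf = 0%N ->
    iter n (@Qop K) (cstt 'X_[k]) = cstt 'X_[U_(jq) *+ n + k].
  move=> kf; elim: n => [|n IH] /=; first by rewrite mulm0n add0m.
  rewrite IH Qop_cstt mderivX0; last first.
    by rewrite mnmDE mulmnE mnm1E kf.
  by rewrite !raddf0 mulr0 subr0 -mpolyXD mulmS addmA.
rewrite itH ?itE ?itQ ?mnmDE ?mulmnE ?mnm1E ?muln0 ?mul0n //.
rewrite -rmorphM -mpolyXD /=; congr (cstt 'X_[_]); apply/mnmP.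
case=> [[|[|[|[|[|//]]]]]] lti; rewrite !mnmDE !mulmnE !mnm1E /=;
  rewrite !(mul0n, mul1n, addn0, add0n); congr (m _); exact: val_inj.
Qed.

Lemma cact_linear_pt (M : lmodType K) (D : hecke_module M) c :
  linear (fun x => cact D x c).
Proof.
move=> a x y; elim/mpoly_lin_ind: c => [b c d IHc IHd||m].
- rewrite !linearP /= IHc IHd !scalerDr !scalerA [b * a]mulrC addrACA.
  by rewrite -!scalerA.
- by rewrite !raddf0 addr0.
- by rewrite !cactX /monact !iter_linear.
Qed.

Lemma act_linear_pt (M : lmodType K) (D : hecke_module M) v :
  linear (fun x => act D x v).
Proof.
move=> a x y; elim/pbwt_ind: v => [|v w IHv IHw|i r c].
- by rewrite !raddf0 addr0.
- by rewrite !raddfD /= IHv IHw addrACA.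
- by rewrite !act_bast cact_linear_pt !iter_linear.
Qed.

Lemma prodt_linearl w : linear (prodt ^~ w).
Proof. exact: act_linear. Qed.

Lemma prodt_linearr v : linear (prodt v).
Proof. exact: act_linear_pt. Qed.

Lemma prodt_tvl v w : prodt (tv * v) w = tv * prodt v w.
Proof. exact: act_T. Qed.

(** As [t] is central, multiplication by it is an endomorphism of the regular module. *)
Lemma prodt_tvr v w : prodt v (tv * w) = tv * prodt v w.
Proof.
apply/esym; apply: (@act_intertwine _ _ _ _ (pbwt_module K) (mult tv)) => x.
- exact: hmTP (pbwt_module K) x.
- exact: hmTF (pbwt_module K) x.
- exact: hmTQ (pbwt_module K) x.
- exact: hmTE (pbwt_module K) x.
- exact: hmTH (pbwt_module K) x.
- exact: hmTZ (pbwt_module K) x.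
- by [].
Qed.

End Product.

(** * The enveloping algebra and its deformation *)

(* [iot] embeds [U g] as the elements without [t], and [tco r] extracts the
   coefficient of [t^r]. *)
Definition uea (K : fieldType) : Type := {poly {mpoly K[5]}}.
HB.instance Definition _ (K : fieldType) := GRing.Zmodule.on (uea K).

HB.lock Definition iot (K : fieldType) (u : uea K) : pbwt K :=
  swapXY ((u : {poly {mpoly K[5]}})%:P).
HB.lock Definition tco (K : fieldType) (r : nat) (v : pbwt K) : uea K :=
  (swapXY (v : {poly {poly {mpoly K[5]}}}))`_r.

Section Uea.
Variable K : fieldType.
Local Notation V := {mpoly K[5]}.
Local Notation Ut := (pbwt K).
Local Notation U := (uea K).

Definition scaleu (a : K) (u : U) : U := (a%:MP : V) *: (u : {poly V}).
Fact scaleuA a b u : scaleu a (scaleu b u) = scaleu (a * b) u.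
Proof. by rewrite /scaleu scalerA mpolyCM. Qed.
Fact scale1u : left_id 1 scaleu.
Proof. by move=> u; rewrite /scaleu mpolyC1 scale1r. Qed.
Fact scaleuDr : right_distributive scaleu +%R.
Proof. by move=> a u v; rewrite /scaleu scalerDr. Qed.
Fact scaleuDl u : {morph scaleu^~ u : a b / a + b}.
Proof. by move=> a b; rewrite /scaleu mpolyCD scalerDl. Qed.
HB.instance Definition _ :=
  GRing.Zmodule_isLmodule.Build K U scaleuA scale1u scaleuDr scaleuDl.

Lemma scaleuE a (u : U) :
  a *: u = ((a%:MP : V)%:P * (u : {poly V}) : {poly V}).
Proof. by rewrite mul_polyC. Qed.

Fact iot_linear : linear (@iot K).
Proof.
move=> a u v; rewrite iot.unlock scaletE scaleuE cstt.unlock.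
rewrite polyCD raddfD /=; congr (_ + _).
rewrite polyCM rmorphM /=; congr (_ * _).
by rewrite swapXY_polyC map_polyC.
Qed.
HB.instance Definition _ := GRing.isLinear.Build K U Ut _ (@iot K) iot_linear.

Let swapXYM (v w : Ut) : swapXY (v * w) = swapXY v * swapXY w.
Proof. exact: (rmorphM swapXY). Qed.

Fact tco_linear r : linear (@tco K r).
Proof.
move=> a u v; rewrite tco.unlock scaletE scaleuE cstt.unlock.
rewrite raddfD /= coefD swapXYM swapXY_polyC map_polyC /=.
by rewrite coefCM.
Qed.
HB.instance Definition _ r :=
  GRing.isLinear.Build K Ut U _ (@tco K r) (tco_linear r).

Lemma tco_iot r (u : U) : tco r (iot u) = u *+ (r == 0%N).
Proof. by rewrite tco.unlock iot.unlock swapXYK coefC; case: eqP. Qed.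

Lemma tco_tv r (v : Ut) : tco r.+1 (tv * v) = tco r v.
Proof.
rewrite tco.unlock tv.unlock swapXYM swapXY_polyC map_polyX mulrC coefMX.
by [].
Qed.

Lemma tco0_tv (v : Ut) : tco 0 (tv * v) = 0.
Proof.
by rewrite tco.unlock tv.unlock swapXYM swapXY_polyC map_polyX mulrC coefMX.
Qed.

Lemma bast_iot i r (c : V) :
  bast i r c = tv ^+ r * iot ((c *: 'X^i : {poly V}) : U).
Proof.
rewrite bast.unlock iot.unlock swapXY_polyC mulrCA; congr (_ * _).
rewrite pv.unlock cstt.unlock -mul_polyC rmorphM /= map_polyC rmorphXn /=.
by rewrite map_polyX mulrC.
Qed.

Lemma pbwt_tind (Pr : Ut -> Prop) :
  Pr 0 -> (forall v w, Pr v -> Pr w -> Pr (v + w)) ->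
  (forall r u, Pr (tv ^+ r * iot u)) -> forall v, Pr v.
Proof. by move=> P0 PD Pb; apply: pbwt_ind => // i r c; rewrite bast_iot. Qed.

Lemma tco_tvX n r (v : Ut) :
  tco n (tv ^+ r * v) = if (r <= n)%N then tco (n - r) v else 0.
Proof.
elim: r n => [|r IH] n; first by rewrite mul1r subn0.
rewrite exprS -mulrA; case: n => [|n]; first by rewrite tco0_tv.
by rewrite tco_tv IH ltnS subSS.
Qed.

Definition mut (r : nat) (a b : U) : U := tco r (prodt (iot a) (iot b)).

Lemma prodt_tvXl r v w : prodt (tv ^+ r * v) w = tv ^+ r * prodt v w :> Ut.
Proof. by elim: r => [|r IH]; rewrite ?mul1r // exprS -!mulrA prodt_tvl IH. Qed.

Lemma prodt_tvXr r v w : prodt v (tv ^+ r * w) = tv ^+ r * prodt v w :> Ut.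
Proof. by elim: r => [|r IH]; rewrite ?mul1r // exprS -!mulrA prodt_tvr IH. Qed.

Lemma prodtDl v v' w : prodt (v + v') w = prodt v w + prodt v' w :> Ut.
Proof. by have := prodt_linearl w 1 v v'; rewrite !scale1r. Qed.
Lemma prodtDr v w w' : prodt v (w + w') = prodt v w + prodt v w' :> Ut.
Proof. by have := prodt_linearr v 1 w w'; rewrite !scale1r. Qed.
Lemma prod0t w : prodt 0 w = 0 :> Ut.
Proof. exact: raddf0. Qed.
Lemma prodt0 v : prodt v 0 = 0 :> Ut.
Proof.
by have := prodtDr v 0 0; rewrite addr0 -{1}[prodt v 0]addr0 => /addrI <-.
Qed.

Fact mut_linearl r b : linear (mut r ^~ b).
Proof. by move=> a u v; rewrite /mut linearP prodt_linearl linearP. Qed.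
Fact mut_linearr r a : linear (mut r a).
Proof. by move=> b u v; rewrite /mut linearP prodt_linearr linearP. Qed.

Lemma mut0l r b : mut r 0 b = 0.
Proof. by rewrite /mut raddf0 prod0t raddf0. Qed.
Lemma mut0r r a : mut r a 0 = 0.
Proof. by rewrite /mut raddf0 prodt0 raddf0. Qed.
Lemma mutDl r a a' b : mut r (a + a') b = mut r a b + mut r a' b.
Proof. by rewrite /mut raddfD prodtDl raddfD. Qed.
Lemma mutDr r a b b' : mut r a (b + b') = mut r a b + mut r a b'.
Proof. by rewrite /mut raddfD prodtDr raddfD. Qed.

(** By bilinearity over [t] one may take [t^r u] and [t^s u'] with [u], [u'] free of [t]; at most
    one term of the double sum then survives. *)
Lemma tco_prodt n v w : tco n (prodt v w) =
  \sum_(i < n.+1) \sum_(j < (n - i).+1) mut (n - i - j) (tco i v) (tco j w).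
Proof.
elim/pbwt_tind: v => [|v v' IHv IHv'|r u].
- rewrite prod0t raddf0 big1 // => i _; rewrite big1 // => j _.
  by rewrite raddf0 mut0l.
- rewrite prodtDl raddfD /= IHv IHv' -big_split; apply: eq_bigr => i _ /=.
  by rewrite -big_split; apply: eq_bigr => j _; rewrite /= raddfD mutDl.
elim/pbwt_tind: w => [|w w' IHw IHw'|s u'].
- rewrite prodt0 raddf0 big1 // => i _; rewrite big1 // => j _.
  by rewrite [tco j 0]raddf0 mut0r.
- rewrite prodtDr raddfD /= IHw IHw' -big_split; apply: eq_bigr => i _ /=.
  by rewrite -big_split; apply: eq_bigr => j _;
    rewrite /= [tco j (_ + _)]raddfD mutDr.
rewrite prodt_tvXl prodt_tvXr tco_tvX.
have coE k (a : U) i : tco i (tv ^+ k * iot a) = a *+ (i == k).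
  rewrite tco_tvX; case: leqP => [leki|ltik]; last by rewrite (ltn_eqF ltik).
  by rewrite tco_iot subn_eq0 eqn_leq leki andbT.
case: leqP => [lern|ltnr]; last first.
  rewrite big1 // => i _; rewrite big1 // => j _; rewrite coE.
  by rewrite ltn_eqF ?mut0l // (leq_ltn_trans _ ltnr) // -ltnS.
rewrite (bigD1 (Ordinal (lern : (r < n.+1)%N))) //= [X in _ + X]big1;
  last first.
  move=> i ne; rewrite big1 // => j _; rewrite coE.
  by have /negPf -> : (i : nat) != r by []; rewrite mut0l.
rewrite addr0 tco_tvX; case: leqP => [les|gts]; last first.
  rewrite big1 // => j _; rewrite [tco j _]coE.
  by rewrite ltn_eqF ?mut0r // (leq_ltn_trans _ gts) // -ltnS.
rewrite (bigD1 (Ordinal (les : (s < (n - r).+1)%N))) //= [X in _ + X]big1;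
  last first.
  move=> j ne; rewrite [tco j _]coE.
  by have /negPf -> : (j : nat) != s by []; rewrite mut0r.
by rewrite addr0 !coE !eqxx.
Qed.

Definition mulu (a b : U) : U := mut 0 a b.
Definition oneu : U := (1 : {poly V}).

Lemma iot1 : iot oneu = 1.
Proof. by rewrite iot.unlock rmorph1. Qed.

Lemma tco0_prodt v w : tco 0 (prodt v w) = mulu (tco 0 v) (tco 0 w).
Proof. by rewrite tco_prodt !big_ord_recl !big_ord0 !addr0. Qed.

Fact muluA : associative mulu.
Proof.
(* Lifting the outer factors makes both sides the [t]-free part of a triple product in [U_t]. *)
move=> a b c; rewrite -[a in LHS](tco_iot 0) -[c in RHS](tco_iot 0).
by rewrite -!tco0_prodt prodtA.
Qed.
Fact mul1u : left_id oneu mulu.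
Proof. by move=> a; rewrite /mulu /mut iot1 prod1t tco_iot. Qed.
Fact mulu1 : right_id oneu mulu.
Proof. by move=> a; rewrite /mulu /mut iot1 prodt1 tco_iot. Qed.
Fact muluDl : left_distributive mulu +%R.
Proof. by move=> a b c; apply: mutDl. Qed.
Fact muluDr : right_distributive mulu +%R.
Proof. by move=> a b c; apply: mutDr. Qed.
Fact oneu_neq0 : oneu != 0.
Proof. exact: oner_neq0. Qed.
HB.instance Definition _ := GRing.Zmodule_isNzRing.Build U
  muluA mul1u mulu1 muluDl muluDr oneu_neq0.

Fact scaleuAl (a : K) (u v : U) : a *: (u * v) = (a *: u) * v.
Proof.
have := mut_linearl 0 v a u 0.
by rewrite addr0 -[mut 0 0 v]/(0 * v) mul0r addr0 => <-.
Qed.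
HB.instance Definition _ := GRing.Lmodule_isLalgebra.Build K U scaleuAl.
Fact scaleuAr (a : K) (u v : U) : a *: (u * v) = u * (a *: v).
Proof.
have := mut_linearr 0 u a v 0.
by rewrite addr0 -[mut 0 u 0]/(u * 0) mulr0 addr0 => <-.
Qed.
HB.instance Definition _ := GRing.Lalgebra_isAlgebra.Build K U scaleuAr.

Lemma tcoM v w : tco 0 (prodt v w) = tco 0 v * tco 0 w :> U.
Proof. exact: tco0_prodt. Qed.

Lemma fps_bilin_tco v w n :
  fps_bilin mut (fun i => tco i v) (fun i => tco i w) n = tco n (prodt v w).
Proof. by rewrite tco_prodt. Qed.

(* Only the first [n + 1] coefficients enter the [n]-th coefficient of a
   product, so polynomials in [t] suffice for associativity. *)
Lemma fps_bilin_eq (a a' b b' : nat -> U) n :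
  (forall i, (i <= n)%N -> a i = a' i) -> (forall i, (i <= n)%N -> b i = b' i)
    ->
  forall m, (m <= n)%N -> fps_bilin mut a b m = fps_bilin mut a' b' m.
Proof.
move=> ea eb m lemn; apply: eq_bigr => i _; apply: eq_bigr => j _.
have lei : (i <= m)%N by rewrite -ltnS.
have lej : (j <= m - i)%N by rewrite -ltnS.
have lejn := leq_trans (leq_trans lej (leq_subr _ _)) lemn.
by rewrite (ea i (leq_trans lei lemn)) (eb j lejn).
Qed.

Definition trunct (n : nat) (a : nat -> U) : Ut :=
  \sum_(i < n.+1) tv ^+ i * iot (a i).

Lemma tco_trunct n a i : (i <= n)%N -> tco i (trunct n a) = a i.
Proof.
move=> lein; rewrite raddf_sum (bigD1 (Ordinal (lein : (i < n.+1)%N))) //=.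
rewrite tco_tvX leqnn subnn tco_iot addrC big1 ?add0r // => j nj.
rewrite tco_tvX; case: leqP => // leji; rewrite tco_iot subn_eq0.
suff /negPf -> : ~~ (i <= j)%N by [].
by rewrite -ltnNge ltn_neqAle leji andbT.
Qed.

Lemma formal_deformation_mut : formal_deformation mut.
Proof.
split=> [r b|r a|a b|a b c n]; [exact: mut_linearl|exact: mut_linearr|by []|].
pose a' := trunct n a; pose b' := trunct n b; pose c' := trunct n c.
have ea i : (i <= n)%N -> a i = tco i a' by move=> le; rewrite tco_trunct.
have eb i : (i <= n)%N -> b i = tco i b' by move=> le; rewrite tco_trunct.
have ec i : (i <= n)%N -> c i = tco i c' by move=> le; rewrite tco_trunct.
have eab i : (i <= n)%N -> fps_bilin mut a b i = tco i (prodt a' b').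
  by move=> le; rewrite -fps_bilin_tco; apply: (fps_bilin_eq ea eb).
have ebc i : (i <= n)%N -> fps_bilin mut b c i = tco i (prodt b' c').
  by move=> le; rewrite -fps_bilin_tco; apply: (fps_bilin_eq eb ec).
rewrite (fps_bilin_eq eab ec (leqnn n)) (fps_bilin_eq ea ebc (leqnn n)).
by rewrite !fps_bilin_tco prodtA.
Qed.

End Uea.

(** * The universal property *)

(** A subspace stable under the generators is stable under the action; [rho_row0] uses this for
    triangular matrices. *)
Lemma act_closed (K : fieldType) (M : lmodType K) (D : hecke_module M)
    (Pr : M -> Prop) :
  (forall a x y, Pr x -> Pr y -> Pr (a *: x + y)) -> Pr 0 ->
  (forall x, Pr x -> [/\ Pr (hmP D x), Pr (hmF D x), Pr (hmQ D x),
     Pr (hmE D x) & [/\ Pr (hmH D x), Pr (hmZ D x) & Pr (hmT D x)]]) ->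
  forall x v, Pr x -> Pr (act D x v).
Proof.
move=> PD P0 Pop x v Px.
have it (f : M -> M) n y : (forall u, Pr u -> Pr (f u)) -> Pr y ->
    Pr (iter n f y) by move=> Pf Py; elim: n => //= n; apply: Pf.
elim/pbwt_ind: v => [|v w IHv IHw|i r c]; first by rewrite raddf0.
  by rewrite raddfD -[X in X + _]scale1r; apply: PD.
rewrite act_bast; apply: (it _) => [u /Pop[]//|];
  apply: (it _) => [u /Pop[_ _ _ _ []//]|].
elim/mpoly_lin_ind: c => [a c d IHc IHd||m]; first by rewrite linearP;
  apply: PD.
  by rewrite raddf0.
rewrite cactX /monact.
apply: (it _) => [u /Pop[]//|]; apply: (it _) => [u /Pop[]//|].
apply: (it _) => [u /Pop[]//|]; apply: (it _) => [u /Pop[_ _ _ _ []//]|].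
by apply: (it _) => // u /Pop[_ _ _ _ []].
Qed.

(* The operators in the order (h, e, f, p, q, z) of the basis of [sl2n3]. *)
Definition hm_op (K : fieldType) (M : lmodType K) (D : hecke_module M)
    (i : 'I_6) : {linear M -> M} :=
  nth (hmZ D) [:: hmH D; hmE D; hmF D; hmP D; hmQ D] i.

Section Envelope.
Variable K : fieldType.
Local Notation V := {mpoly K[5]}.
Local Notation Ut := (pbwt K).
Local Notation U := (uea K).
Local Notation g := (sl2n3 K).
Local Notation Dt := (pbwt_module K).

Lemma act_op (M : lmodType K) (D : hecke_module M) x i v :
  act D x (hm_op Dt i v) = hm_op D i (act D x v).
Proof.
elim/ord6P: i.
- exact: act_H.
- exact: act_E.
- exact: act_F.
- exact: act_P.
- exact: act_Q.
- exact: act_Z.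
Qed.

Definition gent (i : 'I_6) : Ut := hm_op Dt i 1.
Definition genu (i : 'I_6) : U := tco 0 (gent i).

Lemma prodt_gent i v : prodt (gent i) v = hm_op Dt i v.
Proof. by rewrite /prodt act_op act_1. Qed.

Definition uea_incl (x : g) : U := \sum_i coordg i x *: genu i.

Fact uea_incl_linear : linear uea_incl.
Proof.
move=> a x y; rewrite /uea_incl scaler_sumr -big_split.
by apply: eq_bigr => i _; rewrite linearP /= scalerDl scalerA.
Qed.
HB.instance Definition _ := GRing.isLinear.Build K g U _ uea_incl
  uea_incl_linear.

Lemma uea_incl_basis i : uea_incl (basisg K i) = genu i.
Proof.
rewrite /uea_incl (bigD1 i) //= coordg_basis eqxx scale1r big1 ?addr0 //.
by move=> j ne; rewrite coordg_basis (negPf ne) scale0r.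
Qed.

Definition opx (x : g) (v : Ut) : Ut := \sum_i coordg i x *: hm_op Dt i v.

Lemma opxE x v : opx x v = coordg ih x *: Hop v + coordg ie x *: Eop v
  + coordg if_ x *: (cstt 'X_jf * v) + coordg ip x *: (pv * v)
  + coordg iq x *: Qop v + coordg iz x *: (cstt 'X_jz * v).
Proof.
rewrite /opx !big_ord_recl big_ord0 addr0 !addrA.
by do !congr (_ + _); congr (coordg _ x *: _); apply: val_inj.
Qed.

Lemma tco_opx x v : tco 0 (opx x v) = uea_incl x * tco 0 v.
Proof.
rewrite /opx raddf_sum /uea_incl mulr_suml; apply: eq_bigr => i _ /=.
by rewrite linearZ /= -prodt_gent tcoM scalerAl.
Qed.

(** The commutator in [U_t] is the Lie bracket plus [t] times the quantization of [P]; setting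
    [t = 0] gives the map from [g] to [U g]. *)
Lemma opx_comm x y v : opx x (opx y v) - opx y (opx x v) = opx (lie x y) v
  + tv * ((coordg iq x * coordg ip y - coordg ip x * coordg iq y)
    *: (Hop (Hop v) + Hop v *+ 2 + (cstt 'X_jf * Eop v) *+ 4)).
Proof.
have [[ef he] [hq eq fq]] := pbwt_rel v; rewrite /= in ef he hq eq fq.
have qf : Qop (cstt 'X_jf * v) = cstt 'X_jf * Qop v - pv * v.
  by rewrite fq addrK.
rewrite ![opx _ (opx _ _)]opxE !opxE.
have HD u w : Hop (u + w) = Hop u + Hop w :> Ut by exact: raddfD.
have ED u w : Eop (u + w) = Eop u + Eop w :> Ut by exact: raddfD.
have QD u w : Qop (u + w) = Qop u + Qop w :> Ut by exact: raddfD.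
have HZ a u : Hop (a *: u) = a *: Hop u :> Ut by exact: linearZZ.
have EZ a u : Eop (a *: u) = a *: Eop u :> Ut by exact: linearZZ.
have QZ a u : Qop (a *: u) = a *: Qop u :> Ut by exact: linearZZ.
rewrite !(HD, ED, QD, HZ, EZ, QZ).
rewrite !(Hop_pv, Hop_f, Hop_z, Eop_pv, Eop_z, Qop_pv, Qop_z).
rewrite qf ef he hq eq.
rewrite /lie /= !coordgE !scaletE.
have kD a b : cstt (a + b)%:MP = cstt a%:MP + cstt b%:MP :> Ut.
  by rewrite mpolyCD rmorphD.
have kN a : cstt (- a)%:MP = - cstt a%:MP :> Ut by rewrite mpolyCN rmorphN.
have kM a b : cstt (a * b)%:MP = cstt a%:MP * cstt b%:MP :> Ut.
  by rewrite mpolyCM rmorphM.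
have k2 : cstt (2%:R)%:MP = 2%:R :> Ut by rewrite mpolyCD mpolyC1 rmorphD
  rmorph1.
rewrite !(kD, kN, kM, k2); ring.
Qed.

Lemma uea_incl_lie : lie_to_assoc uea_incl.
Proof.
move=> x y; have := congr1 (tco 0) (opx_comm x y 1).
rewrite raddfB raddfD /= tco0_tv addr0 !tco_opx.
have -> : tco 0 1 = 1 :> U by rewrite -iot1 tco_iot.
by rewrite !mulr1.
Qed.

Section Lift.
Variables (A : algType K) (f : {linear g -> A}).
Hypothesis fP : lie_to_assoc f.

Let fb i : A := f (basisg K i).

Definition lmul (a x : A) : A := a * x.
Fact lmul_linear a : linear (lmul a).
Proof. by move=> b x y; rewrite /lmul mulrDr scalerAr. Qed.
HB.instance Definition _ a :=
  GRing.isLinear.Build K A A _ (lmul a) (lmul_linear a).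

Definition zero_op (x : A) : A := 0.
Fact zero_op_linear : linear zero_op.
Proof. by move=> b x y; rewrite /zero_op scaler0 addr0. Qed.
HB.instance Definition _ := GRing.isLinear.Build K A A _ zero_op zero_op_linear.

Let comm i j x : fb i * (fb j * x) =
  fb j * (fb i * x) + f (lie (basisg K i) (basisg K j)) * x.
Proof. by rewrite fP mulrBl !mulrA addrC subrK. Qed.

Let brE i j (y : g) : lie (basisg K i) (basisg K j) = y ->
  forall x, fb i * (fb j * x) = fb j * (fb i * x) + f y * x.
Proof. by move=> <- x; apply: comm. Qed.

Let br0 i j : lie (basisg K i) (basisg K j) = 0 ->
  forall x, fb i * (fb j * x) = fb j * (fb i * x).
Proof. by move=> e x; rewrite (brE e) raddf0 mul0r addr0. Qed.

Local Ltac lie_basis := apply: coordgP; elim/ord6P;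
  rewrite /lie /= !coordgE ?raddf0 ?raddfN ?raddfMn /= !coordg_basis /=; ring.

(** With [t] acting by 0, the relation [hmQP] becomes [[q, p] = z], and a Lie map to [A] is all that
    is required. *)
Definition alg_module : hecke_module A.
Proof.
apply: (@HeckeModule K A (lmul (fb ip)) (lmul (fb if_)) (lmul (fb iq))
  (lmul (fb ie)) (lmul (fb ih)) (lmul (fb iz)) zero_op) => m /=;
  rewrite /lmul /zero_op ?mulr0 ?addr0 //.
- by apply: br0; lie_basis.
- by apply: br0; lie_basis.
- by apply: br0; lie_basis.
- by apply: br0; lie_basis.
- by apply: br0; lie_basis.
- by apply: br0; lie_basis.
- by rewrite (@brE _ _ (- basisg K ip)) ?raddfN ?mulNr //; lie_basis.
- rewrite (@brE _ _ (- (basisg K if_ *+ 2))); last lie_basis.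
  by rewrite raddfN raddfMn mulNr mulrnAl.
- by rewrite (@brE _ _ (basisg K iq)) //; lie_basis.
- rewrite (@brE _ _ (basisg K ie *+ 2)); last lie_basis.
  by rewrite raddfMn mulrnAl.
- by rewrite (@brE _ _ (basisg K iq)) //; lie_basis.
- by rewrite (@brE _ _ (basisg K ih)) //; lie_basis.
- by apply: br0; lie_basis.
- by rewrite (@brE _ _ (basisg K ip)) //; lie_basis.
- by rewrite (@brE _ _ (basisg K iz)) //; lie_basis.
Defined.

Lemma hm_op_alg i x : hm_op alg_module i x = fb i * x.
Proof. by elim/ord6P: i. Qed.

Lemma act_alg_mulr x y v :
  act alg_module (x * y) v = act alg_module x v * y.
Proof.
have rl : linear (fun z : A => z * y).
  by move=> a u w; rewrite mulrDl scalerAl.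
pose psi := HB.pack_for {linear A -> A} (fun z : A => z * y)
  (GRing.isLinear.Build K A A *:%R _ rl).
apply/esym; apply: (@act_intertwine _ _ _ alg_module alg_module psi) => u /=.
- exact/esym/mulrA.
- exact/esym/mulrA.
- exact/esym/mulrA.
- exact/esym/mulrA.
- exact/esym/mulrA.
- exact/esym/mulrA.
- exact: mul0r.
Qed.

(** Since [t] acts by 0, the action factors through [tco 0]. *)
Lemma act_alg_tco x v : act alg_module x (iot (tco 0 v)) = act alg_module x v.
Proof.
elim/pbwt_tind: v => [|v w IHv IHw|[|r] u]; first by rewrite !raddf0.
- by rewrite !raddfD /= IHv IHw.
- by rewrite mul1r tco_iot.
- by rewrite exprS -mulrA tco0_tv !raddf0 act_T.
Qed.

Definition uea_lift (u : U) : A := act alg_module 1 (iot u).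

Fact uea_lift_linear : linear uea_lift.
Proof. by move=> a u v; rewrite /uea_lift !linearP. Qed.
HB.instance Definition _ :=
  GRing.isLinear.Build K U A _ uea_lift uea_lift_linear.

(** A product acts on 1 by successive actions, and the action commutes with right multiplications of
    [A]. *)
Fact uea_lift_monoid : monoid_morphism uea_lift.
Proof.
split=> [|u v]; first by rewrite /uea_lift iot1 act_1.
rewrite /uea_lift -act_alg_mulr mul1r -act_prodt.
by rewrite -[RHS]act_alg_tco tcoM !tco_iot.
Qed.
HB.instance Definition _ :=
  GRing.isMonoidMorphism.Build U A uea_lift uea_lift_monoid.

Lemma uea_lift_gen i : uea_lift (genu i) = fb i.
Proof. by rewrite /uea_lift act_alg_tco act_op act_1 hm_op_alg mulr1. Qed.

Lemma uea_lift_incl x : uea_lift (uea_incl x) = f x.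
Proof.
rewrite /uea_incl raddf_sum {2}[x]sum_coordg raddf_sum.
by apply: eq_bigr => i _; rewrite /= !linearZZ /= uea_lift_gen.
Qed.

(** [G \o tco 0] is a module map from the regular module to [A], hence determined by its value at
    1. *)
Lemma uea_lift_unique (G : {lrmorphism U -> A}) :
  (forall x, G (uea_incl x) = f x) -> G =1 uea_lift.
Proof.
move=> GE u; pose psi : {linear Ut -> A} := G \o tco 0.
have psi_op i v : psi (hm_op Dt i v) = fb i * psi v.
  rewrite /= -prodt_gent tcoM rmorphM; congr (_ * _).
  by rewrite -/(genu i) -uea_incl_basis; apply: GE.
have psi1 : psi 1 = 1 by rewrite /= -iot1 tco_iot rmorph1.
rewrite -[u](tco_iot 0) -[G _]/(psi (iot u)) -[iot u in LHS]prodt1.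
rewrite (@act_intertwine _ _ _ _ alg_module psi) ?psi1 //.
- by rewrite tco_iot.
- exact: (psi_op ip).
- exact: (psi_op if_).
- exact: (psi_op iq).
- exact: (psi_op ie).
- exact: (psi_op ih).
- exact: (psi_op iz).
- by move=> v; rewrite /= /mult tco0_tv raddf0.
Qed.

End Lift.

Lemma universal_enveloping_uea : universal_enveloping uea_incl.
Proof.
split=> [|A f fP]; first exact: uea_incl_lie.
exists (uea_lift fP); split; first exact: uea_lift_incl.
exact: uea_lift_unique.
Qed.

End Envelope.

(** * Non-triviality of the deformation *)

(** The coefficient of [t] in the equivalence, taken on constant series. *)
Lemma trivial_deformation_order1 (K : fieldType) (A : algType K)
    (mu : nat -> A -> A -> A) (phi : nat -> {linear A -> A}) :
  formal_deformation mu -> (forall a, phi 0%N a = a) ->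
  (forall a b, fps_lin phi (fps_bilin mu a b)
               =1 fps_mul (fps_lin phi a) (fps_lin phi b)) ->
  forall a b, phi 1%N (a * b) + mu 1%N a b = a * phi 1%N b + phi 1%N a * b.
Proof.
move=> [mul mur mu0 _] phi0 triv a b.
have mu0l r y : mu r 0 y = 0.
  by have := mul r y 1 0 0; rewrite !scale1r addr0 -{1}[mu r 0 y]addr0 =>
    /addrI <-.
have mu0r r y : mu r y 0 = 0.
  by have := mur r y 1 0 0; rewrite !scale1r addr0 -{1}[mu r y 0]addr0 =>
    /addrI <-.
pose cst (c : A) (n : nat) : A := if n is 0%N then c else 0.
have := triv (cst a) (cst b) 1%N.
rewrite /fps_lin /fps_bilin /fps_mul !big_ord_recl !big_ord0 /=.
rewrite ?(big_ord_recl, big_ord0) /=.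
by rewrite !phi0 !mu0l !mu0r !mu0 !addr0.
Qed.

Section NonTrivial.
Variable K : fieldType.
Local Notation Ut := (pbwt K).
Local Notation U := (uea K).
Local Notation g := (sl2n3 K).
Local Notation Dt := (pbwt_module K).

Let tco1_bast i (c : {mpoly K[5]}) : tco 1 (bast i 0 c) = 0.
Proof. by rewrite bast_iot mul1r tco_iot. Qed.
Let iot_tco_bast i (c : {mpoly K[5]}) : iot (tco 0 (bast i 0 c)) = bast i 0 c.
Proof. by rewrite bast_iot mul1r tco_iot. Qed.

Lemma gent_q : gent K iq = bast 0 0 'X_jq.
Proof.
rewrite /gent /= -(rmorph1 (@cstt K)) Qop_cstt -mpolyC1 mderivC raddf0 mulr0
  subr0.
by rewrite mpolyC1 mulr1 bast00.
Qed.
Lemma gent_p : gent K ip = bast 1 0 1.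
Proof. by rewrite /gent /= /mult -pv_bast bast00 rmorph1. Qed.
Lemma gent_z : gent K iz = bast 0 0 'X_jz.
Proof. by rewrite /gent /= /mult mulr1 bast00. Qed.

Let iot_genu i : [|| i == ip, i == iq | i == iz] -> iot (genu K i) = gent K i.
Proof.
by case/or3P => /eqP ->; rewrite /genu ?gent_p ?gent_q ?gent_z iot_tco_bast.
Qed.

(** The monomial [p q] is already ordered, so no [t] appears. *)
Lemma mut1_pq : mut 1 (genu K ip) (genu K iq) = 0.
Proof.
rewrite /mut !iot_genu // prodt_gent /= /mult gent_q.
by rewrite pv_bast tco1_bast.
Qed.

Lemma mut1_qz : mut 1 (genu K iq) (genu K iz) = mut 1 (genu K iz) (genu K iq).
Proof.
by rewrite /mut !iot_genu // !prodt_gent /gent /= /mult Qop_z.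
Qed.

(** Reordering [q p] produces [t C], and its coefficient is the ordered Casimir element. *)
Lemma mut1_qp : mut 1 (genu K iq) (genu K ip) =
  genu K ih * genu K ih + genu K ih *+ 2 + (genu K if_ * genu K ie) *+ 4.
Proof.
rewrite /mut !iot_genu // prodt_gent [gent K ip]/gent /= /mult Qop_pv.
have -> : Qop 1 = gent K iq by [].
rewrite gent_q pv_bast mulr1 -bast00 2!raddfD /= !tco1_bast !add0r.
rewrite tco_tv 2!raddfD 2!raddfMn /=.
have opE i v : tco 0 (hm_op Dt i v) = genu K i * tco 0 v.
  by rewrite -prodt_gent tcoM.
rewrite -[Hop (Hop 1)]/(hm_op Dt ih (gent K ih)) opE.
by rewrite -[cstt _ * _]/(hm_op Dt if_ (gent K ie)) opE.
Qed.

Definition o0 : 'I_3 := @Ordinal 3 0 isT.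
Definition o1 : 'I_3 := @Ordinal 3 1 isT.
Definition o2 : 'I_3 := @Ordinal 3 2 isT.

Lemma ord3P (Pr : 'I_3 -> Prop) : Pr o0 -> Pr o1 -> Pr o2 -> forall i, Pr i.
Proof.
move=> P0 P1 P2; case=> [[|[|[|//]]]] lti.
- by rewrite (_ : Ordinal lti = o0) //; exact/val_inj.
- by rewrite (_ : Ordinal lti = o1) //; exact/val_inj.
- by rewrite (_ : Ordinal lti = o2) //; exact/val_inj.
Qed.

(* The affine representation on [K + K^2]: [n3] acts through its quotient
   [K^2 = <q, p>] by translations and [sl2] linearly. *)
Definition affine (x : g) : 'M[K]_3 := \matrix_(i, j)
  nth 0 (nth [::] [:: [:: 0; 0; 0];
                      [:: coordg iq x; coordg ih x; coordg ie x];
                      [:: coordg ip x; coordg if_ x; - coordg ih x]] i) j.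

Fact affine_linear : linear affine.
Proof.
move=> a x y; apply/matrixP; elim/ord3P; elim/ord3P;
  rewrite !mxE /= ?linearP /=;
  ring.
Qed.
HB.instance Definition _ :=
  GRing.isLinear.Build K g 'M[K]_3 _ affine affine_linear.

Lemma affine_lie : lie_to_assoc affine.
Proof.
move=> x y; apply/matrixP; elim/ord3P; elim/ord3P;
  rewrite !mxE !big_ord_recl !big_ord0 !mxE /= /lie /= ?coordgE; ring.
Qed.

Local Notation rho := (uea_lift affine_lie).

(** Every generator has zero first row, and so has its product with any matrix; only the corner
    entry of the identity survives. *)
Lemma rho_row0 u : rho u o0 o1 = 0 /\ rho u o0 o2 = 0.
Proof.
apply: (@act_closed _ _ _ (fun a : 'M_3 => a o0 o1 = 0 /\ a o0 o2 = 0)).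
- by move=> a x y [x1 x2] [y1 y2]; rewrite !mxE x1 x2 y1 y2 mulr0 addr0.
- by rewrite !mxE.
- have row0 x (y : 'M_3) j : (affine x *m y) o0 j = 0.
    by rewrite mxE big1 // => k _; rewrite !mxE; elim/ord3P: k;
      rewrite /= mul0r.
  by move=> x _; do ![split]; rewrite /= /lmul /zero_op ?row0 // mxE.
- by rewrite !mxE.
Qed.

(** The entries (0,0) and (1,1) of the first equation give [Z00 = 0] and [Z11 = -3], because the
    right-hand side has no such entries. As [z] acts by 0, the entry (1,0) of the second gives
    [Z00 = Z11]. *)
Lemma affine_obstruction (Z Q P : 'M[K]_3) (b := fun i => affine (basisg K i)) :
  Q o0 o1 = 0 -> Q o0 o2 = 0 -> P o0 o1 = 0 -> P o0 o2 = 0 ->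
  Z + (b ih * b ih + b ih *+ 2 + (b if_ * b ie) *+ 4)
    = b iq * P + Q * b ip - (b ip * Q + P * b iq) ->
  b iq * Z - Z * b iq = b iz * Q - Q * b iz -> 3%:R = 0 :> K.
Proof.
move=> Q1 Q2 P1 P2 eC eZ.
have mul3 (A B : 'M[K]_3) i j : (A * B) i j
    = A i o0 * B o0 j + A i o1 * B o1 j + A i o2 * B o2 j.
  rewrite mxE !big_ord_recl big_ord0 addr0 addrA.
  by congr (_ * _ + _ * _ + _ * _); congr (_ _ _); apply: val_inj.
have bE i : [/\ b i o0 o0 = 0, b i o0 o1 = 0, b i o0 o2 = 0,
   b i o1 o0 = (iq == i)%:R & [/\ b i o1 o1 = (ih == i)%:R,
   b i o1 o2 = (ie == i)%:R, b i o2 o0 = (ip == i)%:R,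
   b i o2 o1 = (if_ == i)%:R & b i o2 o2 = - (ih == i)%:R]].
  by do ![split]; rewrite mxE /= ?coordg_basis.
have addE (A B : 'M[K]_3) i j : (A + B) i j = A i j + B i j by rewrite mxE.
have oppE (A : 'M[K]_3) i j : (- A) i j = - A i j by rewrite mxE.
have mulnE (A : 'M[K]_3) n i j : (A *+ n) i j = A i j *+ n.
  by elim: n => [|n IH]; rewrite ?mxE // !mulrS addE IH.
have e00 := congr1 (fun A : 'M_3 => A o0 o0) eC.
have e11 := congr1 (fun A : 'M_3 => A o1 o1) eC.
have e10 := congr1 (fun A : 'M_3 => A o1 o0) eZ.
move: e00 e11 e10; rewrite /= !(addE, oppE, mulnE, mul3).
have [h00 h01 h02 h10 [h11 h12 h20 h21 h22]] := bE ih.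
have [f00 f01 f02 f10 [f11 f12 f20 f21 f22]] := bE if_.
have [e00 e01 e02 e10 [e11 e12 e20 e21 e22]] := bE ie.
have [p00 p01 p02 p10 [p11 p12 p20 p21 p22]] := bE ip.
have [q00 q01 q02 q10 [q11 q12 q20 q21 q22]] := bE iq.
have [z00 z01 z02 z10 [z11 z12 z20 z21 z22]] := bE iz.
rewrite ?(h00, h01, h02, h10, h11, h12, h20, h21, h22) /=.
rewrite ?(f00, f01, f02, f10, f11, f12, f20, f21, f22) /=.
rewrite ?(e00, e01, e02, e10, e11, e12, e20, e21, e22) /=.
rewrite ?(p00, p01, p02, p10, p11, p12, p20, p21, p22) /=.
rewrite ?(q00, q01, q02, q10, q11, q12, q20, q21, q22) /=.
rewrite ?(z00, z01, z02, z10, z11, z12, z20, z21, z22) /=.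
rewrite Q1 Q2 P1 P2 !(mul0r, mulr0, mul1r, mulr1, addr0, add0r, subr0).
move=> z0 z1 z2.
(* The grouping lets [z1], [z2] and [z0] cancel one summand each. *)
have -> : 3%:R = Z o1 o1 + (1 + (1 + 1)) + (Z o0 o0 - Z o1 o1) - Z o0 o0 by
  ring.
by rewrite z1 z2 z0; ring.
Qed.

Lemma mut_not_trivial : 3%:R != 0 :> K -> ~ trivial_deformation (@mut K).
Proof.
move=> nz3 [phi [phi0 triv]].
have ord1 := trivial_deformation_order1 (formal_deformation_mut K) phi0 triv.
set q := genu K iq; set p := genu K ip; set z := genu K iz.
have comm i j : genu K i * genu K j - genu K j * genu K i
    = uea_incl (lie (basisg K i) (basisg K j)).
  by rewrite uea_incl_lie !uea_incl_basis.
have qp : q * p - p * q = z.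
  rewrite comm /z -uea_incl_basis; congr uea_incl.
  by apply: coordgP; elim/ord6P; rewrite /lie /= !coordgE !coordg_basis /=;
    ring.
have qz : q * z - z * q = 0.
  rewrite comm -(raddf0 (@uea_incl K)); congr uea_incl.
  by apply: coordgP; elim/ord6P; rewrite /lie /= !coordgE raddf0 !coordg_basis
    /=; ring.
have rhoE i : rho (genu K i) = affine (basisg K i) by apply: uea_lift_gen.
(* Difference of the first order identities for [(q, p)] and [(p, q)]. *)
have eqC : phi 1%N z + mut 1 q p = q * phi 1%N p + phi 1%N q * p
    - (p * phi 1%N q + phi 1%N p * q).
  by rewrite -!ord1 mut1_pq addr0 -qp raddfB /= addrAC.
(* Difference of the identities for [(q, z)] and [(z, q)]; the right-hand side is later killed by
   [rho], which sends [z] to 0. *)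
have eqZ : q * phi 1%N z - phi 1%N z * q = z * phi 1%N q - phi 1%N q * z.
  have zq : z * q = q * z by apply/esym/eqP; rewrite -subr_eq0 qz.
  have e : q * phi 1%N z + phi 1%N q * z = z * phi 1%N q + phi 1%N z * q.
    by rewrite -!ord1 mut1_qz zq.
  by rewrite -[q * _](addrK (phi 1%N q * z)) e addrAC addrK.
have := congr1 rho eqZ; have := congr1 rho eqC.
rewrite mut1_qp !(rmorphB, rmorphD, rmorphM, rmorphMn) /= !rhoE.
have [Q1 Q2] := rho_row0 (phi 1%N q); have [P1 P2] := rho_row0 (phi 1%N p).
by move=> eC eZ; move/eqP: nz3; apply; apply: (affine_obstruction Q1 Q2 P1 P2
  eC eZ).
Qed.

End NonTrivial.

(** * The cohomology class of [P] *)

Section Cocycle.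
Variable K : fieldType.
Local Notation g := (sl2n3 K).
Local Notation Sg := {mpoly K[6]}.
Local Notation b := (basisg K).

Lemma sum_ord6 (M : nmodType) (F : 'I_6 -> M) :
  \sum_i F i = F ih + F ie + F if_ + F ip + F iq + F iz.
Proof.
rewrite !big_ord_recl big_ord0 addr0 !addrA.
by do !congr (_ + _); congr (F _); apply: val_inj.
Qed.

Lemma sym_inclE (x : g) : sym_incl x = (coordg ih x)%:MP * 'X_ih
  + (coordg ie x)%:MP * 'X_ie + (coordg if_ x)%:MP * 'X_if_
  + (coordg ip x)%:MP * 'X_ip + (coordg iq x)%:MP * 'X_iq
  + (coordg iz x)%:MP * 'X_iz.
Proof. by rewrite /sym_incl sum_ord6 -!mul_mpolyC. Qed.

Lemma mderiv_casimir i : (casimir K)^`M(i) =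
  ('X_ih * (i == ih)%:R) *+ 2 + (4%:R * ((i == ie)%:R * 'X_if_ + 'X_ie * (i ==
    if_)%:R)).
Proof.
rewrite /casimir expr2 -mulrA mderivD !mderivM !mderivXU.
by rewrite -mpolyC_nat mderivC; ring.
Qed.

(** Only [q] and [p] contribute: [C] is invariant under sl2, and [z] is central. *)
Lemma sym_act_casimir (x : g) : sym_act x (casimir K) =
  (coordg iq x)%:MP * (- ('X_ih * 'X_iq) *+ 2 - ('X_ie * 'X_ip) *+ 4)
  + (coordg ip x)%:MP * (('X_ih * 'X_ip) *+ 2 - ('X_iq * 'X_if_) *+ 4).
Proof.
rewrite /sym_act sum_ord6 !mderiv_casimir /= !sym_inclE /lie /= !coordgE.
rewrite !coordg_basis /=.
rewrite !(mpolyCD, mpolyCN, mpolyCM, mpolyC1, mpolyC0).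
ring.
Qed.

Lemma mem_sl2 (x : g) : x \in sl2 K ->
  [/\ coordg ip x = 0, coordg iq x = 0 & coordg iz x = 0].
Proof.
rewrite /sl2 !span_cons span_nil addv0.
case/memv_addP => _ /vlineP[a1 ->] [_ /memv_addP[_ /vlineP[a2 ->]
  [_ /vlineP[a3 ->] ->]] ->].
by split; rewrite !(linearD, linearZ) /= !coordg_basis /=; ring.
Qed.

Lemma bivPE x y : bivP K x y =
  (coordg iq x * coordg ip y - coordg iq y * coordg ip x)%:MP * casimir K.
Proof. by rewrite /bivP mul_mpolyC. Qed.

Lemma sym_act_bivP w x y : sym_act w (bivP K x y) =
  (coordg iq x * coordg ip y - coordg iq y * coordg ip x)%:MP
  * sym_act w (casimir K).
Proof. by rewrite /bivP linearZ /= mul_mpolyC. Qed.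

(** [C] is invariant, and so is [q^* /\ p^*], because sl2 acts on the span of [q], [p] with trace
    0. *)
Lemma bivP_sl2_invariant : sl2_invariant (restr_n3 (bivP K)).
Proof.
move=> x /mem_sl2[xp xq xz] u v.
rewrite /act_cochain2 /restr_n3 sym_act_bivP sym_act_casimir !ad_n3E !bivPE.
rewrite /lie /= !coordgE xp xq; case/mem_n3P: (subvsP u);
  case/mem_n3P: (subvsP v).
rewrite -/(n3_incl u) -/(n3_incl v) => v0 v1 v2 u0 u1 u2.
rewrite u0 u1 u2 v0 v1 v2 !(mpolyCD, mpolyCN, mpolyCM, mpolyC1, mpolyC0).
ring.
Qed.

Lemma biderivation_incl (B : g -> g -> Sg) F w : (forall x, linear (B x)) ->
  biderivation B F (sym_incl w) = \sum_i B (b i) w * F^`M(i).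
Proof.
move=> Bl; apply: eq_bigr => i _.
have BE : B (b i) w = \sum_j coordg j w *: B (b i) (b j).
  pose Bi := HB.pack_for {linear g -> Sg} (B (b i))
    (GRing.isLinear.Build K g Sg *:%R _ (Bl (b i))).
  rewrite {1}[w]sum_coordg -[B (b i)]/(Bi : g -> Sg) raddf_sum.
  by apply: eq_bigr => j _; exact: (linearZZ Bi).
rewrite BE mulr_suml; apply: eq_bigr => j _.
by rewrite mderiv_sym_incl -mul_mpolyC; ring.
Qed.

Lemma bivP_linearr x : linear (bivP K x).
Proof.
by move=> a y w; rewrite !bivPE -mul_mpolyC !linearP /= !(mpolyCD, mpolyCN,
  mpolyCM); ring.
Qed.

Lemma bivP_linearl y : linear (bivP K ^~ y).
Proof.
by move=> a x w; rewrite !bivPE -mul_mpolyC !linearP /= !(mpolyCD, mpolyCN,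
  mpolyCM); ring.
Qed.

Lemma biderivation_bivP F w : biderivation (bivP K) F (sym_incl w) =
  casimir K * ((coordg ip w)%:MP * F^`M(iq) - (coordg iq w)%:MP * F^`M(ip)).
Proof.
rewrite (biderivation_incl _ _ bivP_linearr) sum_ord6 !bivPE !coordg_basis /=.
by rewrite !(mpolyCD, mpolyCN, mpolyCM, mpolyC1, mpolyC0); ring.
Qed.

(** The Hamiltonian field of a linear function is the action of [g]; the sign comes from the order
    of the arguments. *)
Lemma biderivation_poisson0 F w :
  biderivation (poisson0 K) F (sym_incl w) = - sym_act w F.
Proof.
rewrite biderivation_incl => [|x a y z]; last first.
  by rewrite /poisson0 lie_linearr linearP.
rewrite /sym_act -sumrN; apply: eq_bigr => i _.
by rewrite /poisson0 lieN raddfN mulNr.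
Qed.

(** [P] differentiates along [p] and [q] only, while its coefficient [C] depends on [h], [e],
    [f]. *)
Lemma schouten_bivP x y w : schouten2 (bivP K) (bivP K) x y w = 0.
Proof.
rewrite /schouten2 !biderivation_bivP /bivP !mderivZ !mderiv_casimir /=.
by rewrite -!mul_mpolyC; ring.
Qed.

(** On [n3] the sum is a 3-form in [q^*] and [p^*] alone, hence zero; with an argument in sl2 it
    reflects the invariance of [P]. *)
Lemma schouten_poisson0_bivP x y w : schouten2 (poisson0 K) (bivP K) x y w = 0.
Proof.
rewrite /schouten2 !biderivation_bivP !biderivation_poisson0.
rewrite !sym_act_bivP !sym_act_casimir /poisson0 !mderiv_sym_incl /lie /=
  !coordgE.
rewrite !(mpolyCD, mpolyCN, mpolyCM, mpolyC1, mpolyC0).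
ring.
Qed.

Let n3_coord (u : n3 K) : [/\ coordg ih (n3_incl u) = 0,
  coordg ie (n3_incl u) = 0 & coordg if_ (n3_incl u) = 0].
Proof. by case/mem_n3P: (subvsP u). Qed.

Lemma bivP_in_H2_invariants : in_H2_invariants (restr_n3 (bivP K)).
Proof.
split; last first.
  (* [P] is invariant as a cochain, so its variation bounds the zero cochain. *)
  move=> x xs; exists \0 => u v; rewrite bivP_sl2_invariant // /ce_d1 /=.
  by rewrite /sym_act_n3 !raddf0 ?subr0 ?addr0.
split; first split.
- by move=> v a x y; rewrite /restr_n3 n3_incl_linear bivP_linearl.
- by move=> v a x y; rewrite /restr_n3 n3_incl_linear bivP_linearr.
- by move=> x; rewrite /restr_n3 bivPE subrr mpolyC0 mul0r.
move=> x y w; rewrite /ce_d2 /restr_n3 /sym_act_n3 !bracket_n3E.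
rewrite !sym_act_bivP !sym_act_casimir !bivPE /lie /= !coordgE.
have [x0 x1 x2] := n3_coord x; have [y0 y1 y2] := n3_coord y.
have [w0 w1 w2] := n3_coord w; rewrite x0 x1 x2 y0 y1 y2 w0 w1 w2.
rewrite !(mpolyCD, mpolyCN, mpolyCM, mpolyC1, mpolyC0).
ring.
Qed.

Lemma sym_act_q F : sym_act (b iq) F =
  'X_iz * F^`M(ip) - 'X_iq * F^`M(ih) - 'X_ip * F^`M(if_).
Proof.
rewrite /sym_act sum_ord6 !sym_inclE /lie /= !coordgE !coordg_basis /=.
by rewrite !(mpolyCD, mpolyCN, mpolyCM, mpolyC1, mpolyC0); ring.
Qed.

Lemma sym_act_p F : sym_act (b ip) F =
  'X_ip * F^`M(ih) - 'X_iz * F^`M(iq) - 'X_iq * F^`M(ie).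
Proof.
rewrite /sym_act sum_ord6 !sym_inclE /lie /= !coordgE !coordg_basis /=.
by rewrite !(mpolyCD, mpolyCN, mpolyCM, mpolyC1, mpolyC0); ring.
Qed.

Lemma sym_act_z F : sym_act (b iz) F = 0.
Proof.
rewrite /sym_act sum_ord6 !sym_inclE /lie /= !coordgE !coordg_basis /=.
by rewrite !(mpolyCD, mpolyCN, mpolyCM, mpolyC1, mpolyC0); ring.
Qed.

(** Meaningful at the indices of [p], [q], [z], where the basis vector lies in [n3]. *)
Definition n3_basis (i : 'I_6) : n3 K := vsproj (n3_vspace K) (b i).

Lemma n3_basisE (i : 'I_6) : (2 < i)%N -> n3_incl (n3_basis i) = b i.
Proof.
move=> i2; rewrite /n3_incl vsprojK //; apply/mem_n3P.
by move: i i2; apply: ord6P => // _; rewrite !coordg_basis.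
Qed.

Lemma bivP_not_coboundary : 2%:R != 0 :> K ->
  ~ ce_cohomologous2 (sym_act_n3 K) (restr_n3 (bivP K)) (fun _ _ => 0).
Proof.
move=> nz2 [phi phiE].
set p := n3_basis ip; set q := n3_basis iq; set z := n3_basis iz.
have [pE qE zE] : [/\ n3_incl p = b ip, n3_incl q = b iq & n3_incl z = b iz].
  by rewrite !n3_basisE.
have qp : lie q p = z.
  apply: n3_incl_inj; rewrite bracket_n3E pE qE zE.
  by apply: coordgP; elim/ord6P; rewrite /lie /= !coordgE !coordg_basis /=;
    ring.
have zq : lie z q = 0.
  apply: n3_incl_inj; rewrite bracket_n3E zE qE n3_incl0.
  by apply: coordgP; elim/ord6P; rewrite /lie /= !coordgE raddf0 !coordg_basis
    /=; ring.
have := phiE z q; have := phiE q p.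
rewrite !subr0 /ce_d1 /sym_act_n3 /restr_n3 !bivPE qp zq raddf0 pE qE zE.
rewrite sym_act_z !sym_act_q sym_act_p !coordg_basis /=.
rewrite !(mulr0, mulr1, mul0r, subr0, oppr0, mpolyC1, mpolyC0, mul1r, sub0r)
  => eC eZ.
(* The point [h = 1] with all other coordinates 0, where [dC/dh] equals 2. *)
pose v (i : 'I_6) : K := (i == ih)%:R.
(* As [q] and [p] act into the ideal [(p, q, z)], this reads [2 = - d(phi z)/dh] at [v]. *)
have := congr1 (fun F : Sg => (F^`M(ih)).@[v]) eC.
(* Deriving [q . phi z] along [q] isolates [d(phi z)/dh] at [v], which is therefore 0. *)
have := congr1 (fun F : Sg => (F^`M(iq)).@[v]) eZ.
rewrite mderiv_casimir !(mderiv0, mderivB, mderivD, mderivN, mderivM,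
  mderivXU) /=.
rewrite !(mevalB, mevalD, mevalN, mevalM, mevalXU, mevalMn, meval0, meval1) /=.
rewrite /v /= !(mul0r, mul1r, mulr0, addr0, add0r, subr0, sub0r, oppr0, opprK).
move=> <-; rewrite oppr0 => two0; move/eqP: nz2; apply.
by rewrite -two0 mulr2n.
Qed.

End Cocycle.

Local Open Scope complex_scope.

Theorem proposition6p2 (R : realType) :
  [/\ sl2_invariant (restr_n3 (bivP R[i])),
      (forall x y w : sl2n3 R[i],
         schouten2 (bivP R[i]) (bivP R[i]) x y w = 0),
      (forall x y w : sl2n3 R[i],
         schouten2 (poisson0 R[i]) (bivP R[i]) x y w = 0),
      (in_H2_invariants (restr_n3 (bivP R[i])) /\
       ~ ce_cohomologous2 (sym_act_n3 R[i]) (restr_n3 (bivP R[i]))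
           (fun _ _ => 0))
    & ~ strongly_rigid (sl2n3 R[i])].
Proof.
split.
- exact: bivP_sl2_invariant.
- exact: schouten_bivP.
- exact: schouten_poisson0_bivP.
- split; first exact: bivP_in_H2_invariants.
  by apply: bivP_not_coboundary; rewrite Num.Theory.pnatr_eq0.
- move=> rigid_g; apply: (@mut_not_trivial R[i]).
    by rewrite Num.Theory.pnatr_eq0.
  apply: rigid_g (universal_enveloping_uea R[i]) _ _.
  exact: formal_deformation_mut.
Qed.
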